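(* Let $n \geq 3$, let $p > 0$ be a prime, and let $\mathbb{K}$ be a field of characteristic $p$. Then $$\mathrm{NL}(n,p) \;=\; \mathbb{Z}_{\geq 2}^n \cap \bigcup_{e\geq 1}\ \bigcup_{\mathbf{b}\in \Gamma_n} \left( B_{r_{p^e}}^+(p^e\mathbf{1}) + p^e\mathbf{b} \right),$$ where $\mathrm{NL}(n,p)$ is the set of exponent vectors $\mathbf{c}\in\mathbb{Z}_{\geq 2}^n$ for which $A_{\mathbf{c}}$ fails the weak Lefschetz property, and $r_q = (n-2)(q-1)-1$ for $q=p^e$.
   Context: For $\mathbf{c} = (c_1,\ldots,c_n) \in \mathbb{Z}_{\geq 2}^n$, let $A_{\mathbf{c}} := \mathbb{K}[x_1,\ldots,x_n]/(x_1^{c_1},\ldots,x_n^{c_n})$ with the standard grading. $A_{\mathbf{c}}$ has the weak Lefschetz property (WLP) if there exists a linear form $\ell \in A_{\mathbf{c}}$ such that the multiplication map $\times \ell : [A_{\mathbf{c}}]_i \to [A_{\mathbf{c}}]_{i+1}$ has maximal rank (i.e. is injective or surjective) for every $i \geq 0$. $\mathrm{NL}(n,p)$ denotes the set of $\mathbf{c}\in\mathbb{Z}_{\geq 2}^n$ for which $A_{\mathbf{c}}$ fails the WLP. Write $\|\cdot\|_1$ for the taxicab norm $\|\mathbf{a}\|_1=\sum_i |a_i|$ and $\mathbf{1} = (1,\ldots,1)\in\mathbb{Z}^n$. Define $$\Gamma_n := \{ \mathbf{b} \in \mathbb{Z}_{\geq 0}^n : \|\mathbf{b}\|_1 \text{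 is even and } 2\max_i b_i \leq \|\mathbf{b}\|_1 \}.$$ For $\mathbf{a}\in\mathbb{Z}^n$ and $r \in \mathbb{Z}_{\geq 0}$, let $B_r^+(\mathbf{a}) := \{\mathbf{u}\in(\mathbb{Z}_{\geq 1})^n : \|\mathbf{u}-\mathbf{a}\|_1\leq r\}$. For $q = p^e$ with $e\geq 1$, put $r_q := (n-2)(q-1)-1$. The notation $B_{r_q}^+(q\mathbf{1}) + q\mathbf{b}$ means the pointwise translation of every vector of $B_{r_q}^+(q\mathbf{1})$ by $q\mathbf{b}$. *)

(* Defs.v *)
From HB Require Import structures.
From mathcomp Require Import all_boot all_order all_algebra.
From mathcomp Require Import ring_quotient.
From mathcomp Require Import mpoly.
From mathcomp Require Import boolp classical_sets.

Set Implicit Arguments.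
Unset Strict Implicit.
Unset Printing Implicit Defensive.

Import Order.TTheory GRing.Theory Num.Theory.
Local Open Scope classical_set_scope.
Local Open Scope ring_scope.
Local Open Scope quotient_scope.

Definition Zge2 (n : nat) : set 'rV[int]_n :=
  [set c : 'rV[int]_n | forall i, 2 <= c 0 i].

Arguments Zge2 : clear implicits.

(* The bound on the entries is bundled with the vector because MathComp ring
   quotients are by proper ideals, and (x_1^c_1, ..., x_n^c_n) is proper only
   if no c_i vanishes. *)
Record expvec (n : nat) := Expvec {
  expval :> 'rV[int]_n;
  expvecP : Zge2 n expval
}.

Section MonomialCompleteIntersection.
Variables (K : fieldType) (n : nat) (c : expvec n).

Definition ci_ideal : {pred {mpoly K[n]}} :=
  fun f => `[< exists g : 'I_n -> {mpoly K[n]},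
                 f = \sum_(i < n) g i * 'X_i ^+ absz (c 0 i) >].

Lemma ci_idealr_closed : idealr_closed ci_ideal.
Proof.
split.
- apply/asboolP; exists (fun=> 0).
  by rewrite big1 // => i _; rewrite mul0r.
- apply/negP => /asboolP [g /(congr1 (meval (fun=> 0)))].
  rewrite meval1 raddf_sum /= big1 => [/eqP|i _]; first by rewrite oner_eq0.
  rewrite mevalM rmorphXn /= mevalXU expr0n.
  by case: (c 0 i) (expvecP c i) => [[|k]|k] //=; rewrite mulr0.
- move=> a f g /asboolP [u ->] /asboolP [v ->]; apply/asboolP.
  exists (fun i => a * u i + v i).
  rewrite mulr_sumr -big_split /=; apply: eq_bigr => i _.
  by rewrite mulrDl mulrA.
Qed.

HB.instance Definition _ :=
  isIdealr.Build {mpoly K[n]} ci_ideal ci_idealr_closed.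

Definition ci_algebra : Type := {ideal_quot ci_ideal}.

Definition ci_piece (i : nat) : set ci_algebra :=
  [set \pi_ci_algebra f | f in [set f : {mpoly K[n]} | f \is i.-homog]].

Definition max_rank (l : ci_algebra) (i : nat) : Prop :=
  {in ci_piece i &, injective (fun x => l * x)} \/
  [set l * x | x in ci_piece i] = ci_piece i.+1.

Definition WLP : Prop := exists2 l, ci_piece 1 l & forall i, max_rank l i.

End MonomialCompleteIntersection.

Definition NL (K : fieldType) (n : nat) : set 'rV[int]_n :=
  [set expval c | c in [set c : expvec n | ~ WLP K c]].
Arguments NL : clear implicits.

Definition norm1 (n : nat) (a : 'rV[int]_n) : int := \sum_(i < n) `|a 0 i|.

(* The default value 0 of the maximum is harmless: the entries are nonnegative. *)
Definition Gamma (n : nat) : set 'rV[int]_n :=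
  [set b : 'rV[int]_n | [/\ forall i, 0 <= b 0 i,
               (2 %| norm1 b)%Z &
               2 * \big[Num.max/0]_(i < n) b 0 i <= norm1 b]].
Arguments Gamma : clear implicits.

Definition posball (n : nat) (r : int) (a : 'rV[int]_n) : set 'rV[int]_n :=
  [set u : 'rV[int]_n | (forall i, 1 <= u 0 i) /\ norm1 (u - a) <= r].

(* Over int, so that the subtractions are not truncated. *)
Definition radius (n : nat) (q : int) : int := (n%:Z - 2) * (q - 1) - 1.

(* Main.v *)
Require Import Defs.
From mathcomp Require Import all_boot all_order all_algebra.
From mathcomp Require Import ring_quotient mpoly.
From mathcomp Require Import boolp classical_sets.
From mathcomp Require Import zify ring.

(* Since A_c is Gorenstein with socle degree s = sum (c_i - 1), the WLP fails iff every linear form l kills a nonzero form of some degree d with 2 d < s, and then l may be taken to be the sum of the variables.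

   If c = q (1 + b) + v with b in Gamma_n, counting monomials gives a nonzero form f of degree |b| / 2 in A_(1 + b) killed by l with q-th powers of coefficients; then l^q kills f(x^q) x^(v+) in A_c, and the last nonzero l^j f(x^q) x^(v+) has degree at most q - 1 + q |b| / 2 + |v+|, which is small enough exactly when |v| <= (n - 2) (q - 1) - 1.

   Conversely, a form of degree d killed by l satisfies s - 2 d + 1 <= (n - 2) (q - 1) + 1 - |c - q (1 + b)| for some q = p^e, e >= 0, and some b in Gamma_n. For n = 3 this is Han's theorem, proved following Monsky: a syzygy of x^a, y^b, (x + y)^c can be moved, without loss, towards a local maximum of its gap, where a Wronskian argument shows that its three terms lie in K[x^p, y^p]. For larger n the kernel element is split along x_1, x_2 into a form in x_1, x_2 and a form in the other variables, both killed by the L-th power of the sum of their variables; this gives one triangle (c_1, c_2, L) and one shorter vector (L, c_3, ..., c_n), whose apices are glued along the common entry. *)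

Set Implicit Arguments.
Unset Strict Implicit.
Unset Printing Implicit Defensive.

Import Order.TTheory GRing.Theory Num.Theory.

(** * Couplings and their rounding *)

Definition dist (x y : nat) : nat := (x - y) + (y - x).

Lemma dist_triangle y x z : dist x z <= dist x y + dist y z.
Proof. rewrite /dist; lia. Qed.

Lemma distC x y : dist x y = dist y x.
Proof. by rewrite /dist addnC. Qed.

(* This is the condition (a, b, c) \in Gamma_3. *)
Definition triangle (a b c : nat) : bool :=
  [&& ~~ odd (a + b + c), a <= b + c, b <= a + c & c <= a + b].

(* The polygon with sides [b0 :: s] is cut into triangles by the diagonals through one of its vertices. *)
Fixpoint fan (b0 : nat) (s : seq nat) : Prop :=
  if s is b :: s' then exists2 b', triangle b0 b b' & fan b' s' else b0 = 0.

(* In the coordinates [b1 + b2] and [b1 - b2] the taxicab norm becomes a maximum and the triangle inequalities decouple, so each coordinate is rounded separately. *)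
Lemma triangle_round_exact Q a0 b0 b1 b2 : 0 < Q -> triangle b0 b1 b2 ->
    b0.+1 = Q * a0.+1 ->
  exists d1 d2, triangle a0 d1 d2 /\
    dist b1.+1 (Q * d1.+1) + dist b2.+1 (Q * d2.+1) <= Q.-1.
Proof.
move=> Q0 /and4P[od h0 h1 h2] e0.
(* [k] rounds the sum and [k'] the difference of the two sides: the witnesses satisfy d1 + d2 = a0 +
   2 k and d1 - d2 = 2 k' - a0. *)
pose k := (b1 + b2 + 2 - Q * a0.+1) %/ (2 * Q).
pose k' := (b1 + Q * a0.+1 - b2) %/ (2 * Q).
have eu := divn_eq (b1 + b2 + 2 - Q * a0.+1) (2 * Q).
have ev := divn_eq (b1 + Q * a0.+1 - b2) (2 * Q).
have Q2 : 0 < 2 * Q by lia.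
have := ltn_pmod (b1 + b2 + 2 - Q * a0.+1) Q2.
have := ltn_pmod (b1 + Q * a0.+1 - b2) Q2.
rewrite -/k -/k' in eu ev.
move: (_ %% _) ev => r' ev ; move: (_ %% _) eu => r eu ltr' ltr.
have k'le : k' <= a0.
  rewrite -ltnS /k' ltn_divLR //.
  have -> : a0.+1 * (2 * Q) = 2 * (Q * a0.+1) by lia.
  by rewrite -e0; lia.
exists (k + k'), (a0 + k - k').
have {}eu : b1 + b2 + 2 = Q * a0.+1 + 2 * (k * Q) + r by nia.
have {}ev : b1 + Q * a0.+1 = b2 + 2 * (k' * Q) + r' by nia.
split; first by rewrite /triangle; lia.
have -> : Q * (k + k').+1 = Q + k * Q + k' * Q by nia.
have -> : Q * (a0 + k - k').+1 = Q * a0.+1 + k * Q - k' * Q by nia.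
have : k' * Q <= Q * a0 by nia.
rewrite mulnS in eu ev e0 *.
rewrite /dist.
move: (k * Q) (k' * Q) (Q * a0) eu ev e0 => X Y Z eu ev e0 YZ.
(* Parity excludes the remainder 0, so both [r] and [r'] are within Q - 1 of Q; without it the bound
   would be Q. *)
have oX : odd r by lia.
have oY : odd r' by lia.
clear -Q0 eu ev ltr ltr' oX oY YZ.
lia.
Qed.

(** Lengthening [b0] is matched by lengthening [b1] equally. Shortening it by one is matched by
    shortening the longer of the other two sides by one. *)
Lemma triangle_shift a0 b0 b1 b2 : triangle b0 b1 b2 ->
  exists d1 d2, triangle a0 d1 d2 /\ dist b1 d1 + dist b2 d2 <= dist b0 a0.
Proof.
have up t x y z : triangle x y z -> triangle (x + t) (y + t) z by rewrite /triangle; lia.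
have down t x y z : triangle (x + t) y z ->
    exists y' z', triangle x y' z' /\ dist y y' + dist z z' <= t.
  elim: t y z => [|t IH] y z h.
    by exists y, z; rewrite addn0 in h; split=> //; rewrite /dist; lia.
  case: (leqP z y) => zy.
    have /IH [y' [z' [h' le]]] : triangle (x + t) y.-1 z.
      by move: h; rewrite /triangle; lia.
    exists y', z'; split=> //; move: h le; rewrite /triangle /dist; lia.
  have /IH [y' [z' [h' le]]] : triangle (x + t) y z.-1.
    by move: h; rewrite /triangle; lia.
  exists y', z'; split=> //; move: h le; rewrite /triangle /dist; lia.
move=> h; case: (leqP b0 a0) => le.
  exists (b1 + (a0 - b0)), b2; split; last by rewrite /dist; lia.
  by rewrite -{1}(subnKC le); apply: up.
have [|y [z [h' le']]] := down (b0 - a0) a0 b1 b2.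
  by rewrite subnKC // ltnW.
by exists y, z; split=> //; move: le'; rewrite /dist; lia.
Qed.

Lemma triangle_round Q a0 b0 b1 b2 : 0 < Q -> triangle b0 b1 b2 ->
  exists d1 d2, triangle a0 d1 d2 /\
    dist b1.+1 (Q * d1.+1) + dist b2.+1 (Q * d2.+1)
      <= Q.-1 + dist b0.+1 (Q * a0.+1).
Proof.
move=> Q0 h.
have [x [y [h' le']]] := triangle_shift (Q * a0.+1).-1 h.
have Qa : (Q * a0.+1).-1.+1 = Q * a0.+1 by rewrite prednK // muln_gt0 Q0.
have [d1 [d2 [hd le]]] := triangle_round_exact Q0 h' Qa.
exists d1, d2; split=> //; rewrite -Qa.
set q := _.-1 in le' *.
have S u v : dist u.+1 v.+1 = dist u v by rewrite /dist; lia.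
have := dist_triangle x.+1 b1.+1 (Q * d1.+1).
have := dist_triangle y.+1 b2.+1 (Q * d2.+1).
by rewrite !S; move: (dist _ _) (dist _ _) (dist _ _) (dist _ _) (dist _ _)
  (dist _ _) (dist _ _) le le'; lia.
Qed.

(** * Taxicab distance of lists and rounding of fans *)

Definition dists (c d : seq nat) : nat :=
  \sum_(xy <- zip c d) dist xy.1 xy.2.

Lemma dists_cons x y c d : dists (x :: c) (y :: d) = dist x y + dists c d.
Proof. by rewrite /dists /= big_cons. Qed.

Lemma dists0 : dists [::] [::] = 0.
Proof. by rewrite /dists big_nil. Qed.

Lemma dists_triangle c d e : size c = size d -> size d = size e ->
  dists c e <= dists c d + dists d e.
Proof.
elim: c d e => [|x c IH] [|y d] [|z e] //=.
  by rewrite !dists0.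
move=> [h1] [h2]; rewrite !dists_cons.
by have := IH _ _ h1 h2; have := dist_triangle y x z; lia.
Qed.

Lemma dists_scale Q c d : size c = size d ->
  dists (map (muln Q) c) (map (muln Q) d) = Q * dists c d.
Proof.
elim: c d => [|x c IH] [|y d] //= => [_|[h]].
  by rewrite dists0 muln0.
by rewrite !dists_cons IH // mulnDr /dist !mulnDr !mulnBr.
Qed.

(** The error on one diagonal is passed on to the next triangle, so the costs Q - 1 just add up. The
    last triangle is degenerate with two equal sides and costs nothing, hence [(size s).-1]. *)
Lemma fan_round Q a b s : 0 < Q -> s != [::] -> fan b s ->
  exists ds, [/\ size ds = size s, fan a ds &
    dists (map succn s) (map (fun d => Q * d.+1) ds)
      <= (size s).-1 * Q.-1 + dist b.+1 (Q * a.+1)].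
Proof.
move=> Q0; elim: s a b => [//|b1 s IH] a b _ /= [b' tb gs].
have [se|sn] := altP (s =P [::]).
  move: gs; rewrite se /= => b'0; exists [:: a]; split=> //=.
    by exists 0 => //; rewrite /triangle; lia.
  rewrite dists_cons dists0.
  suff -> : b = b1 by lia.
  by move: tb; rewrite /triangle; lia.
have [d1 [d2 [td le]]] := triangle_round a Q0 tb.
have [ds [sz gd led]] := IH d2 _ sn gs.
exists (d1 :: ds); split; rewrite /= ?sz //; first by exists d2.
rewrite dists_cons.
have -> : size s = (size s).-1.+1 by rewrite prednK // lt0n size_eq0.
rewrite mulSn; lia.
Qed.

(** The taxicab distance of c from the apex q (1 + b), the centre of a translated ball. *)
Definition near q (c b : seq nat) : nat := dists c (map (fun x => q * x.+1) b).

Lemma near_cons q x c y b :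
  near q (x :: c) (y :: b) = dist x (q * y.+1) + near q c b.
Proof. exact: dists_cons. Qed.

Lemma predM q Q : 0 < q -> 0 < Q -> q * Q.-1 + q.-1 = (q * Q).-1.
Proof. by case: q Q => [|q] [|Q] //= _ _; rewrite mulnS addnC; lia. Qed.

(* A triangle at scale [p ^ e1] and a fan at scale [p ^ e2] share the edge [L]; the finer of the two is rounded to the coarser scale. *)
Lemma glue p e1 e2 c1 c2 L c a1 a2 al b bs : 0 < p -> c != [::] ->
    triangle a1 a2 al -> fan b bs -> size bs = size c ->
  exists e x xs, [/\ fan x xs, size xs = (size c).+1 &
    near (p ^ e) [:: c1, c2 & c] (x :: xs)
      + (p ^ e1).-1 + (size c).-1 * (p ^ e2).-1 <=
    size c * (p ^ e).-1 +
      (near (p ^ e1) [:: c1; c2; L] [:: a1; a2; al] +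
       near (p ^ e2) (L :: c) (b :: bs))].
Proof.
move=> p0 cn ta gb sz.
have bn : bs != [::] by rewrite -size_eq0 sz size_eq0.
have s1 : size c = (size c).-1.+1 by rewrite prednK // lt0n size_eq0.
have pe k : 0 < p ^ k by rewrite expn_gt0 p0.
case: (leqP e2 e1) => e12.
  have [ds [szd gd led]] := fan_round al (pe (e1 - e2)) bn gb.
  exists e1, a1, (a2 :: ds); split; rewrite /= ?szd ?sz //.
    by exists al.
  rewrite !near_cons /near /=.
  have E : p ^ e1 = p ^ e2 * p ^ (e1 - e2) by rewrite -expnD subnKC.
  set q1 := p ^ e1 in E *; set q2 := p ^ e2 in E *; set Q := p ^ (e1 - e2) in E led.
  have h1 : 0 < q2 := pe e2. have h2 : 0 < Q := pe (e1 - e2).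
  have lec : dists c [seq q1 * x.+1 | x <- ds] <=
     dists c [seq q2 * x.+1 | x <- bs] + q2 * ((size bs).-1 * Q.-1 + dist b.+1 (Q * al.+1)).
    apply: leq_trans (dists_triangle (d := [seq q2 * x.+1 | x <- bs]) _ _) _.
    - by rewrite size_map.
    - by rewrite !size_map szd.
    rewrite leq_add2l.
    have -> : [seq q2 * x.+1 | x <- bs] = map (muln q2) (map succn bs).
      by rewrite -map_comp.
    have -> : [seq q1 * x.+1 | x <- ds] = map (muln q2) (map (fun d => Q * d.+1) ds).
      by rewrite -map_comp E; apply: eq_map => x /=; rewrite mulnA.
    by rewrite dists_scale ?size_map ?szd // leq_mul2l led orbT.
  have qd : q2 * dist b.+1 (Q * al.+1) = dist (q2 * b.+1) (q1 * al.+1).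
    by rewrite E /dist mulnDr !mulnBr !mulnA.
  (* The cost of rounding is exactly the difference of the radius terms at the two scales. *)
  have qq : q2 * Q.-1 = q1.-1 - q2.-1.
    by rewrite E -(predM h1 h2) addnK.
  have q12 : q2.-1 <= q1.-1.
    by rewrite E -(predM h1 h2) leq_addl.
  move: lec; rewrite mulnDr qd mulnCA qq mulnBr sz => lec.
  have m12 : (size c).-1 * q2.-1 <= (size c).-1 * q1.-1 by rewrite leq_mul2l q12 orbT.
  rewrite {2}s1 mulSn dists0.
  have := dist_triangle L (q2 * b.+1) (q1 * al.+1).
  rewrite (distC (q2 * _) L).
  move: lec m12; clear; move: (_ * q1.-1) (_ * q2.-1); lia.
have ta' : triangle al a1 a2 by move: ta; rewrite /triangle; lia.
have [d1 [d2 [td led]]] := triangle_round b (pe (e2 - e1)) ta'.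
exists e2, d1, (d2 :: bs); split; rewrite /= ?sz //.
  by exists b => //; move: td; rewrite /triangle; lia.
rewrite !near_cons /near /=.
have E : p ^ e2 = p ^ e1 * p ^ (e2 - e1) by rewrite -expnD subnKC // ltnW.
set q2 := p ^ e2 in E *; set q1 := p ^ e1 in E *; set Q := p ^ (e2 - e1) in E led.
have h1 : 0 < q1 := pe e1. have h2 : 0 < Q := pe (e2 - e1).
have qd x y : q1 * dist x.+1 (Q * y.+1) = dist (q1 * x.+1) (q2 * y.+1).
  by rewrite E /dist mulnDr !mulnBr !mulnA.
have qq : q1 * Q.-1 = q2.-1 - q1.-1.
  by rewrite E -(predM h1 h2) addnK.
have q12 : q1.-1 <= q2.-1 by rewrite E -(predM h1 h2) leq_addl.
have : q1 * (dist a1.+1 (Q * d1.+1) + dist a2.+1 (Q * d2.+1)) <= q1 * (Q.-1 + dist al.+1 (Q * b.+1)).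
  by rewrite leq_mul2l led orbT.
rewrite mulnDr (mulnDr q1 Q.-1) !qd qq {2}s1 mulSn dists0.
have := dist_triangle (q1 * a1.+1) c1 (q2 * d1.+1).
have := dist_triangle (q1 * a2.+1) c2 (q2 * d2.+1).
have := dist_triangle L (q1 * al.+1) (q2 * b.+1).
rewrite (distC (q1 * al.+1) L).
move: q12; clear; move: (_ * q2.-1); lia.
Qed.

(** A polygon cut into triangles satisfies the parity and length conditions that define Gamma. *)
Lemma fan_bound b s : fan b s ->
  [/\ ~~ odd (b + sumn s), b <= sumn s &
      forall x, x \in s -> 2 * x <= b + sumn s].
Proof.
elim: s b => [|y s IH] b /=; first by move=> ->.
move=> [b' t /IH[o le al]]; split; try by move: t; rewrite /triangle; lia.
move=> x; rewrite inE => /predU1P[->|/al]; move: t; rewrite /triangle; lia.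
Qed.

(** * Syzygies of three powers of linear forms *)

Lemma near3 q a b c x y z : near q [:: a; b; c] [:: x; y; z] =
  dist a (q * x.+1) + dist b (q * y.+1) + dist c (q * z.+1).
Proof. by rewrite !near_cons /near dists0 addn0 addnA. Qed.

(* The gap [a + b + c - 2 * al] of a syzygy of degree [al] is at most [q - |(a, b, c) - q (1 + (x, y, z))|] for [q = p ^ e]. *)
Definition near_apex (p a b c al : nat) : Prop :=
  exists e x y z, triangle x y z /\
    a + b + c + near (p ^ e) [:: a; b; c] [:: x; y; z] <= p ^ e + 2 * al.

(** A move that enlarges the gap by at least its own length can be undone, by the triangle
    inequality. This justifies climbing to a local maximum of the gap. *)
Lemma near_apex_le p a b c al a' b' c' al' : near_apex p a' b' c' al' ->
  a + b + c + (dist a a' + dist b b' + dist c c') + 2 * al'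
    <= a' + b' + c' + 2 * al ->
  near_apex p a b c al.
Proof.
move=> [e [x [y [z [t le]]]]] h; exists e, x, y, z; split=> //.
move: le; rewrite !near3.
have := dist_triangle a' a (p ^ e * x.+1).
have := dist_triangle b' b (p ^ e * y.+1).
have := dist_triangle c' c (p ^ e * z.+1).
lia.
Qed.

Lemma near_apex_muln p a b c al : near_apex p a b c al ->
  near_apex p (p * a) (p * b) (p * c) (p * al).
Proof.
move=> [e [x [y [z [t le]]]]]; exists e.+1, x, y, z; split=> //.
have := leq_mul (leqnn p) le; rewrite !near3 !expnS.
have E u v : dist (p * u) (p * p ^ e * v) = p * dist u (p ^ e * v).
  by rewrite -mulnA /dist mulnDr !mulnBr.
rewrite !E; lia.
Qed.


(** * Univariate polynomials: Wronskians and vanishing derivatives *)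

Section Polynomials.
Local Open Scope ring_scope.
Variable K : fieldType.
Implicit Types A B C l u v : {poly K}.

(** Differentiation costs only one factor of a power of [l]. *)
Lemma dvdp_wronskian l A v a :
  l ^+ a.-1 %| A * l ^+ a * v^`() - (A * l ^+ a)^`() * v.
Proof.
case: a => [|a] /=; first by rewrite expr0 dvd1p.
rewrite derivM deriv_exp /= exprSr.
apply/dvdpP; exists (A * l * v^`() - (A^`() * l + A * l^`() *+ a.+1) * v).
have id (R : comNzRingType) (a0 L l0 w a1 m N z : R) :
    a0 * (L * l0) * w - (a1 * (L * l0) + a0 * (N * (m * L))) * z =
    (a0 * l0 * w - (a1 * l0 + N * (a0 * m)) * z) * L by ring.
by rewrite -(mulr_natl (_ * l ^+ a)) -(mulr_natl (A * _)); apply: id.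
Qed.

(** The derivative is (A' l + a A) l^(a-1); if a were invertible in K, its vanishing would make [l]
    divide [A]. *)
Lemma deriv_eq0_mul_exp l A a : l != 0 -> l^`() = 1 -> ~~ (l %| A) ->
  (A * l ^+ a)^`() = 0 -> a%:R = 0 :> K /\ A^`() = 0.
Proof.
move=> l0 dl ndv; case: a => [|a]; first by rewrite expr0 mulr1.
rewrite derivM deriv_exp /= dl mul1r => /eqP.
rewrite mulrnAr exprS mulrA -mulrnAl -mulrDl mulf_eq0 expf_eq0 (negPf l0) andbF.
rewrite orbF => /eqP h.
have [a0|a0] := eqVneq (a.+1%:R : K) 0.
  split=> //; move: h; rewrite -mulr_natr -polyC_natr a0 mulr0 addr0.
  by move/eqP; rewrite mulf_eq0 (negPf l0) orbF => /eqP.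
case/negP: ndv; apply/dvdpP.
exists (- a.+1%:R^-1 *: A^`()).
rewrite -scalerAl scaleNr -scalerN.
have -> : - (A^`() * l) = A *+ a.+1.
  by apply/eqP; rewrite eq_sym -addr_eq0 addrC h.
by rewrite -scaler_nat scalerA mulVf // scale1r.
Qed.

Lemma deriv_eq0_comp p A : p \in [pchar K] -> A^`() = 0 ->
  exists A1, A = A1 \Po 'X^p.
Proof.
move=> hp dA; have p0 : (0 < p)%N := prime_gt0 (pcharf_prime hp).
exists (\poly_(i < size A) A`_(p * i)); apply/polyP => i.
rewrite coef_comp_poly_Xn // coef_poly.
have [/dvdnP[k ->]|ndv] := boolP (p %| i)%N.
  rewrite mulnK // mulnC; case: ltnP => // h.
  by rewrite nth_default // (leq_trans h) // leq_pmull.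
case: i ndv => [|i] ndv; first by rewrite dvdn0 in ndv.
have /eqP := congr1 (fun P : {poly K} => P`_i) dA.
rewrite coef_deriv coef0 -mulr_natr mulf_eq0 -(dvdn_pcharf hp) (negPf ndv) orbF.
by move/eqP.
Qed.

Lemma size_comp_Xn p A : (0 < p)%N -> A != 0 ->
  size (A \Po 'X^p) = ((size A).-1 * p).+1.
Proof.
move=> p0 A0; have := size_comp_poly A 'X^p; rewrite size_polyXn /= => <-.
rewrite prednK // size_poly_gt0 comp_poly_eq0 // size_polyXn; lia.
Qed.


Lemma size_dvd l A : l != 0 -> A != 0 -> l %| A ->
  exists A1, [/\ A = A1 * l, A1 != 0 & (size A1 + (size l).-1 = size A)%N].
Proof.
move=> l0 A0 /dvdpP[A1 E]; exists A1.
have A10 : A1 != 0 by apply: contraNneq A0; rewrite E => ->; rewrite mul0r.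
split=> //; rewrite E size_mul //.
by move: l0; rewrite -size_poly_gt0; case: (size l) => // k _; rewrite addnS.
Qed.

(** By coprimality u divides its own derivative, which has smaller degree and so vanishes. *)
Lemma coprimep_wronskian u v : u != 0 -> coprimep u v ->
  u * v^`() - u^`() * v = 0 -> u^`() = 0 /\ v^`() = 0.
Proof.
move=> u0 cuv /eqP; rewrite subr_eq0 => /eqP W.
have u'0 : u^`() = 0.
  apply/eqP; apply: contraTT (lt_size_deriv u0) => u'n0.
  rewrite -leqNgt dvdp_leq // -(Gauss_dvdpl _ cuv) -W.
  by rewrite dvdp_mulr.
by split=> //; move/eqP: W; rewrite u'0 mul0r mulf_eq0 (negPf u0) => /eqP.
Qed.

(** Binary forms in x, y are dehomogenized at y = 1: [Z] stands for x + y, and divisibility by y^b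
    becomes a bound on the size. *)
Let Z : {poly K} := 'X + 1.

Let ZE : Z = 'X - (-1)%:P.
Proof. by rewrite polyCN opprK. Qed.

Let Z0 : Z != 0.
Proof. by rewrite ZE polyXsubC_eq0. Qed.

Let sZ : size Z = 2.
Proof. by rewrite ZE size_XsubC. Qed.

Let dZ : Z^`() = 1.
Proof. by rewrite derivD derivX derivC addr0. Qed.

Let coprimep_X l : coprimep l 'X = ~~ ('X %| l).
Proof. by rewrite coprimepX root_factor_theorem subr0. Qed.

Let coprimep_Z l : coprimep l Z = ~~ (Z %| l).
Proof. by rewrite ZE coprimep_XsubC root_factor_theorem. Qed.

Let cXZ : coprimep 'X Z.
Proof.
rewrite coprimep_Z ZE -root_factor_theorem rootX oppr_eq0.
exact: oner_neq0.
Qed.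

Lemma size_exp_Z c : size (Z ^+ c) = c.+1.
Proof.
have := size_exp Z c; rewrite sZ mul1n => {2}<-.
by rewrite prednK // size_poly_gt0 expf_neq0.
Qed.

(** * Syzygies of x^a, y^b, (x + y)^c in characteristic p *)

Section Syzygy.
Variables (p : nat) (hp : p \in [pchar K]).

(* At a locally maximal syzygy the three terms are pairwise coprime, and the Mason-Stothers estimate for their Wronskian forces it to vanish. *)
Lemma syzygy_coprime a b c al A B C :
    A != 0 -> B != 0 -> C != 0 -> A * 'X^a + B + C * Z ^+ c = 0 ->
    (size A + a <= al.+1)%N -> (size B + b <= al.+1)%N ->
    (2 * al + 2 <= a + b + c)%N -> (0 < a)%N -> (0 < c)%N ->
    ~~ ('X %| A) -> ~~ (('X %| B) && ('X %| C)) ->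
    ~~ (Z %| C) -> ~~ ((Z %| A) && (Z %| B)) ->
    (forall l, l %| A -> l %| B -> l %| C -> size l = 1) ->
  [/\ A^`() = 0, B^`() = 0, C^`() = 0, (p %| a)%N & (p %| c)%N].
Proof.
move=> A0 B0 C0 E sA sB gap a0 c0 XA XBC ZC ZAB cop.
set u := A * 'X^a in E; set w := C * Z ^+ c in E.
have u0 : u != 0 by rewrite mulf_neq0 // expf_neq0 // polyX_eq0.
have wE : w = - (u + B) by apply/eqP; rewrite -addr_eq0 addrC E.
have cuB : coprimep u B.
  rewrite coprimep_def; apply/eqP; apply: cop.
  - have := dvdp_gcdl u B; rewrite /u Gauss_dvdpl // coprimep_expr //.
    rewrite coprimep_X; apply/negP => Xg.
    have XB := dvdp_trans Xg (dvdp_gcdr _ _).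
    have : 'X %| w.
      by rewrite wE dvdpNr dvdp_add // (dvdp_trans Xg (dvdp_gcdl _ _)).
    rewrite /w Gauss_dvdpl ?coprimep_expr // => XC.
    by rewrite XB XC in XBC.
  - exact: dvdp_gcdr.
  - have : gcdp u B %| w by rewrite wE dvdpNr dvdp_add ?dvdp_gcdl ?dvdp_gcdr.
    rewrite /w Gauss_dvdpl // coprimep_expr //.
    rewrite coprimep_Z; apply/negP => Zg.
    have ZB := dvdp_trans Zg (dvdp_gcdr _ _).
    have := dvdp_trans Zg (dvdp_gcdl _ _).
    rewrite /u Gauss_dvdpl; last by rewrite coprimep_expr // coprimep_sym.
    by move=> ZA; rewrite ZA ZB in ZAB.
have W0 : u * B^`() - u^`() * B = 0.
  apply/eqP; apply/negPn/negP => Wn0.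
  have d1 := dvdp_wronskian 'X A B a.
  (* As u + B + w = 0, the Wronskian of u and B is also that of w and u. It is then divisible by
     X^(a-1) Z^(c-1), whose degree is too large since the gap is at least 2. *)
  have : Z ^+ c.-1 %| u * B^`() - u^`() * B.
    have -> : u * B^`() - u^`() * B = w * u^`() - w^`() * u.
      by rewrite wE derivN derivD; ring.
    exact: dvdp_wronskian.
  move=> d2; have : 'X^(a.-1) * Z ^+ c.-1 %| u * B^`() - u^`() * B.
    by rewrite Gauss_dvdp ?d1 // coprimep_expl // coprimep_expr.
  move=> /(dvdp_leq Wn0); rewrite size_mul ?expf_neq0 ?polyX_eq0 //.
  rewrite size_polyXn size_exp_Z.
  have su : size u = (size A + a)%N by rewrite /u size_mulXn // addnC.
  have s0 : (0 < size u)%N by rewrite size_poly_gt0.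
  have sb0 : (0 < size B)%N by rewrite size_poly_gt0.
  have s1 : (size (u * B^`())%R <= size u + size B - 2)%N.
    apply: leq_trans (size_polyMleq _ _) _.
    move: (lt_size_deriv B0) s0 sb0; move: (size _) (size _) (size _); clear; lia.
  have s2 : (size (u^`() * B)%R <= size u + size B - 2)%N.
    apply: leq_trans (size_polyMleq _ _) _.
    move: (lt_size_deriv u0) s0 sb0; move: (size _) (size _) (size _); clear; lia.
  have : (size (u * B^`() - u^`() * B)%R <= size u + size B - 2)%N.
    apply: leq_trans (size_polyD _ _) _.
    by rewrite size_polyN geq_max s1 s2.
  rewrite su; move: sA sB gap a0 c0; clear; move: (size _) (size _) (size _).
  lia.
have [u'0 B'0] := coprimep_wronskian u0 cuB W0.
have w'0 : w^`() = 0 by rewrite wE derivN derivD u'0 B'0 addr0 oppr0.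
have [|a1 A'0] := deriv_eq0_mul_exp _ (derivX _) XA u'0.
  by rewrite polyX_eq0.
have [c1 C'0] := deriv_eq0_mul_exp Z0 dZ ZC w'0.
by split; rewrite ?(dvdn_pcharf hp) ?a1 ?c1 ?eqxx.
Qed.

Lemma comp_syzygy a c A B C :
  (A \Po 'X^p) * 'X^(p * a) + (B \Po 'X^p) + (C \Po 'X^p) * Z ^+ (p * c) =
  (A * 'X^a + B + C * Z ^+ c) \Po 'X^p.
Proof.
have ZX n : Z ^+ n \Po 'X^p = Z ^+ (p * n).
  have chP : p \in [pchar {poly K}] by rewrite pchar_poly.
  have ZpE : Z ^+ p = 'X^p + 1.
    by rewrite exprDn_pchar ?expr1n // pnatE ?(pcharf_prime hp).
  rewrite exprM ZpE; elim: n => [|n IH]; first by rewrite !expr0 -polyC1 comp_polyC.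
  by rewrite !exprS comp_polyM IH comp_polyD comp_polyX -polyC1 comp_polyC.
by rewrite !comp_polyD !comp_polyM ZX comp_Xn_poly -exprM.
Qed.

(** Induction on 4 al - (a + b + c). A common factor, or a factor x, y, x + y not yet absorbed in
    the exponents, gives a move to a larger gap. Once none is left, all terms are polynomials in X^p
    and a Frobenius substitution is undone. *)
Lemma syzygy_near_apex a b c al A B C :
    A != 0 -> B != 0 -> C != 0 -> A * 'X^a + B + C * Z ^+ c = 0 ->
    (size A + a <= al.+1)%N -> (size B + b <= al.+1)%N ->
    (size C + c <= al.+1)%N ->
    (a <= b + c)%N -> (b <= a + c)%N -> (c <= a + b)%N ->
    (2 * al < a + b + c)%N ->
  near_apex p a b c al.
Proof.
have p0 : (0 < p)%N := prime_gt0 (pcharf_prime hp).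
have p1 : (1 < p)%N := prime_gt1 (pcharf_prime hp).
have [n] := ubnP (4 * al - (a + b + c))%N.
elim: n => // n IH in a b c al A B C *; rewrite ltnS => lt_n.
move=> A0 B0 C0 E sA sB sC tA tB tC gap.
have [] : [/\ (0 < size A)%N, (0 < size B)%N & (0 < size C)%N].
  by rewrite !size_poly_gt0.
move=> pA pB pC.
have [aal bal cal] : [/\ (a <= al)%N, (b <= al)%N & (c <= al)%N].
  move: pA pB pC sA sB sC; clear; move: (size _) (size _) (size _).
  by split; lia.
(* At gap 1 the vector (a, b, c) is itself an apex at scale p^0; odd parity makes the triangle
   inequalities strict. *)
have [gap1|gap2] : a + b + c = (2 * al).+1 \/ (2 * al + 2 <= a + b + c)%N.
- by clear -gap; lia.
- exists 0, a.-1, b.-1, c.-1; rewrite near3 expn0 !mul1n /triangle /dist.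
  by clear -gap1 tA tB tC; lia.
have [a0 b0 c0] : [/\ (0 < a)%N, (0 < b)%N & (0 < c)%N].
  by clear -gap2 aal bal cal; split; lia.
have next a' b' c' al' A' B' C' : A' != 0 -> B' != 0 -> C' != 0 ->
    A' * 'X^a' + B' + C' * Z ^+ c' = 0 ->
    (size A' + a' <= al'.+1)%N -> (size B' + b' <= al'.+1)%N ->
    (size C' + c' <= al'.+1)%N ->
    (4 * al' + (a + b + c) < 4 * al + (a' + b' + c'))%N ->
    (a + b + c + (dist a a' + dist b b' + dist c c') + 2 * al'
       <= a' + b' + c' + 2 * al)%N ->
    near_apex p a b c al.
  move=> h1 h2 h3 h4 h5 h6 h7 h8 h9.
  have [] : [/\ (0 < size A')%N, (0 < size B')%N & (0 < size C')%N].
    by rewrite !size_poly_gt0.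
  move: (h5) (h6) (h7); move: (size _) (size _) (size _) => s1 s2 s3.
  move=> k5 k6 k7 k1 k2 k3.
  apply: (near_apex_le _ h9); move: h9; rewrite /dist => h9.
  apply: (IH _ _ _ _ _ _ _ _ h1 h2 h3 h4 h5 h6 h7);
    clear -lt_n k5 k6 k7 k1 k2 k3 h8 h9 gap2 aal bal cal; lia.
have X0 : ('X : {poly K}) != 0 by rewrite polyX_eq0.
have sX : size ('X : {poly K}) = 2 by rewrite size_polyX.
have [XA|XA] := boolP ('X %| A).
  have [A1 [EA A10]] := size_dvd X0 A0 XA; rewrite sX /= => sA1.
  apply: (next a.+1 b c al A1 B C) => //.
  - by rewrite exprS mulrA -EA.
  - by rewrite addnS -addSn -addn1 sA1.
  - by clear; lia.
  - by rewrite /dist; clear; lia.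
have [ZC|ZC] := boolP (Z %| C).
  have [C1 [EC C10]] := size_dvd Z0 C0 ZC; rewrite sZ /= => sC1.
  apply: (next a b c.+1 al A B C1) => //.
  - by rewrite exprS mulrA -EC.
  - by rewrite addnS -addSn -addn1 sC1.
  - by clear; lia.
  - by rewrite /dist; clear; lia.
have [/andP[XB XC]|XBC] := boolP (('X %| B) && ('X %| C)).
  have [B1 [EB B10]] := size_dvd X0 B0 XB; rewrite sX /= => sB1.
  have [C1 [EC C10]] := size_dvd X0 C0 XC; rewrite sX /= => sC1.
  apply: (next a.-1 b c al.-1 A B1 C1) => //.
  - apply: (mulIf X0); rewrite mul0r -E EB EC -{2}(prednK a0) exprSr.
    by clear; ring.
  - by move: sA a0 aal; clear; move: (size _); lia.
  - by move: sB sB1 a0 aal; clear; move: (size _) (size _); lia.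
  - by move: sC sC1 a0 aal; clear; move: (size _) (size _); lia.
  - by clear -a0 aal; lia.
  - by rewrite /dist; clear -a0 aal; lia.
have [/andP[ZA ZB]|ZAB] := boolP ((Z %| A) && (Z %| B)).
  have [B1 [EB B10]] := size_dvd Z0 B0 ZB; rewrite sZ /= => sB1.
  have [A1 [EA A10]] := size_dvd Z0 A0 ZA; rewrite sZ /= => sA1.
  apply: (next a b c.-1 al.-1 A1 B1 C) => //.
  - apply: (mulIf Z0); rewrite mul0r -E EB EA -{2}(prednK c0) exprSr.
    by clear; ring.
  - by move: sA sA1 a0 aal; clear; move: (size _) (size _); lia.
  - by move: sB sB1 a0 aal; clear; move: (size _) (size _); lia.
  - by move: sC c0 cal; clear; move: (size _); lia.
  - by clear -c0 cal; lia.
  - by rewrite /dist; clear -c0 cal; lia.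
(* The factor y is treated like x and x + y above; here it shows as slack in the size bounds. *)
have [sB'|sB'] := leqP (size B + b)%N al.
  apply: (next a b.+1 c al A B C) => //.
  - by rewrite addnS.
  - by clear; lia.
  - by rewrite /dist; clear; lia.
have [/andP[sA' sC']|sAC] := boolP ((size A + a <= al) && (size C + c <= al))%N.
  apply: (next a b.-1 c al.-1 A B C) => //.
  - by rewrite prednK // (leq_trans b0).
  - by move: sB b0 bal; clear; move: (size _); lia.
  - by rewrite prednK // (leq_trans b0).
  - by clear -b0 bal; lia.
  - by rewrite /dist; clear -b0 bal; lia.
have [l1|] := eqVneq (size (gcdp (gcdp A B) C)) 1; last first.
  set l := gcdp _ _ => ln1.
  have lC : l %| C := dvdp_gcdr _ _.
  have lA : l %| A := dvdp_trans (dvdp_gcdl _ _) (dvdp_gcdl _ _).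
  have lB : l %| B := dvdp_trans (dvdp_gcdl _ _) (dvdp_gcdr _ _).
  have l0 : l != 0 by rewrite gcdp_eq0 (negPf C0) andbF.
  have ls : (1 < size l)%N by move: l0 ln1; rewrite -size_poly_gt0; case: (size l) => [|[|k]].
  have [A1 [EA A10 sA1]] := size_dvd l0 A0 lA.
  have [B1 [EB B10 sB1]] := size_dvd l0 B0 lB.
  have [C1 [EC C10 sC1]] := size_dvd l0 C0 lC.
  have := dvdp_leq A0 lA => lsA.
  apply: (next a b c (al - (size l).-1)%N A1 B1 C1) => //.
  - apply: (mulIf l0); rewrite mul0r -E EB EC EA.
    by clear; ring.
  - by move: sA sA1 lsA; clear; move: (size _) (size _) (size _); lia.
  - by move: sB sB1 sA lsA; clear; move: (size _) (size _) (size _) (size _); lia.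
  - by move: sC sC1 sA lsA; clear; move: (size _) (size _) (size _) (size _); lia.
  - by move: sA lsA ls; clear; move: (size _) (size _); lia.
  - by rewrite /dist; clear; lia.
have cop l : l %| A -> l %| B -> l %| C -> size l = 1.
  move=> lA lB lC; have : l %| gcdp (gcdp A B) C by rewrite !dvdp_gcd lA lB.
  move=> lg; apply/eqP; rewrite eqn_leq size_poly_gt0; apply/andP; split.
    rewrite -l1; apply: dvdp_leq lg.
    by rewrite gcdp_eq0 (negPf C0) andbF.
  by apply: contraNneq A0 => l0; move: lA; rewrite l0 dvd0p.
have [dA dB dC pa pc] :=
  syzygy_coprime A0 B0 C0 E sA sB gap2 a0 c0 XA XBC ZC ZAB cop.
have [A1 EA] := deriv_eq0_comp hp dA.
have [B1 EB] := deriv_eq0_comp hp dB.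
have [C1 EC] := deriv_eq0_comp hp dC.
have nz (D D1 : {poly K}) : D != 0 -> D = D1 \Po 'X^p -> D1 != 0.
  by move=> D0 ED; apply: contraNneq D0; rewrite ED => ->; rewrite comp_poly0.
have A10 := nz _ _ A0 EA; have B10 := nz _ _ B0 EB; have C10 := nz _ _ C0 EC.
move: pa pc => /dvdnP[a' ea] /dvdnP[c' ec].
have [s1 s2 s3] : [/\ size A = ((size A1).-1 * p).+1,
    size B = ((size B1).-1 * p).+1 & size C = ((size C1).-1 * p).+1].
  by rewrite EA EB EC !size_comp_Xn.
(* One of the terms A x^a, C (x + y)^c reaches the full degree al, and its degree is a multiple of
   p. The size of [B] then does the same for b. *)
have /dvdnP[al' eal] : (p %| al)%N.
  move: sAC; rewrite negb_and -!ltnNge => /orP[] h.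
    have -> : al = (((size A1).-1 + a') * p)%N.
      by move: h sA; rewrite s1 ea; clear; move: (_.-1) => k; lia.
    exact: dvdn_mull.
  have -> : al = (((size C1).-1 + c') * p)%N.
    by move: h sC; rewrite s3 ec; clear; move: (_.-1) => k; lia.
  exact: dvdn_mull.
have /dvdnP[b' eb] : (p %| b)%N.
  have -> : b = ((al' - (size B1).-1) * p)%N.
    by rewrite mulnBl -eal; move: sB' sB; rewrite s2; clear; lia.
  exact: dvdn_mull.
rewrite ea eb ec eal ![(_ * p)%N]mulnC; apply: near_apex_muln.
have lep x y : (x * p <= y * p)%N -> (x <= y)%N by rewrite leq_pmul2r.
have sz (D : {poly K}) x : D != 0 ->
    (((size D).-1 * p).+1 + x * p <= (al' * p).+1)%N -> (size D + x <= al'.+1)%N.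
  rewrite -size_poly_gt0; case: (size D) => // k _ /=.
  by rewrite addSn !ltnS -mulnDl; apply: lep.
apply: (IH _ _ _ _ A1 B1 C1) => //.
- apply: leq_trans lt_n; rewrite eal ea eb ec.
  move: gap2 a0 aal bal cal; rewrite eal ea eb ec; clear -p1.
  by nia.
- apply/eqP; rewrite -(comp_poly_eq0 _ (q := 'X^p)); last by rewrite size_polyXn.
  by rewrite -comp_syzygy ![(p * _)%N]mulnC -ea -ec -EA -EB -EC E.
- by apply: sz => //; rewrite -s1 -ea -eal.
- by apply: sz => //; rewrite -s2 -eb -eal.
- by apply: sz => //; rewrite -s3 -ec -eal.
- by apply: lep; rewrite mulnDl -ea -eb -ec.
- by apply: lep; rewrite mulnDl -ea -eb -ec.
- by apply: lep; rewrite mulnDl -ea -eb -ec.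
- by rewrite -(ltn_pmul2r p0) -mulnA -eal !mulnDl -ea -eb -ec.
Qed.

(** The degenerate apex (c1, c2, c1 + c2 - 1) at scale p^0 suffices for such a long third side. *)
Lemma near_apex_out c1 c2 L al : (0 < c1)%N -> (0 < c2)%N ->
  (c1 + c2 <= L)%N -> (L <= al)%N -> near_apex p c1 c2 L al.
Proof.
move=> h1 h2 h3 h4; exists 0, c1.-1, c2.-1, (c1.-1 + c2.-1)%N.
rewrite near3 expn0 !mul1n /triangle /dist; clear -h1 h2 h3 h4; lia.
Qed.

(** Here v is a binary form of degree d, dehomogenized. As v (x + y)^L has no monomial inside the
    box, cutting it at x^c1 splits it into multiples of x^c1 and y^c2, a syzygy of degree d + L. *)
Lemma pair_near_apex c1 c2 L d v :
    (0 < c1)%N -> (0 < c2)%N -> (0 < L)%N -> v != 0 ->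
    (forall i, v`_i != 0 -> [/\ i < c1, i <= d & d - i < c2]%N) ->
    (forall i, (i < c1)%N -> (i <= d + L)%N -> (d + L - i < c2)%N ->
       (v * Z ^+ L)`_i = 0) ->
  near_apex p c1 c2 L (d + L).
Proof.
move=> c1_0 c2_0 L0 v0 vi Pi; set P := v * Z ^+ L in Pi.
have P0 : P != 0 by rewrite mulf_neq0 // expf_neq0.
have sP : size P = (size v + L)%N.
  by rewrite size_mul ?expf_neq0 // size_exp_Z addnS.
have sv0 : (0 < size v)%N by rewrite size_poly_gt0.
have Pn0 : P`_(size P).-1 != 0 by rewrite -lead_coefE lead_coef_eq0.
have [v1 v2 v3] : [/\ size v <= c1, size v <= d.+1 & d.+1 < size v + c2]%N.
  have /vi : v`_(size v).-1 != 0 by rewrite -lead_coefE lead_coef_eq0.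
  move: sv0; clear; move: (size v) => k k0 [] h1 h2 h3; split; lia.
have dv2 : 'X^c1 %| P -> False.
  rewrite Gauss_dvdpl; last by rewrite coprimep_expl // coprimep_expr.
  by move=> /(dvdp_leq v0); rewrite size_polyXn ltnNge v1.
have [h|hL] := leqP (c1 + c2) L.
  by apply: near_apex_out => //; rewrite leq_addl.
have [h|h1] := leqP (c2 + L) c1.
  suff h' : (c1 <= d + L)%N.
    have [e [x [y [z [t le]]]]] := near_apex_out c2_0 L0 h h'.
    exists e, z, x, y; split; first by move: t; rewrite /triangle; clear; lia.
    by move: le; rewrite !near3; clear; lia.
  rewrite leqNgt; apply/negP => lt.
  case/negP: Pn0; rewrite Pi ?eqxx // sP;
    by move: v1 v2 v3 lt h sv0 L0; clear; move: (size v) => k; lia.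
have [h|h2] := leqP (c1 + L) c2.
  suff h' : (c2 <= d + L)%N.
    have [e [x [y [z [t le]]]]] := near_apex_out c1_0 L0 h h'.
    exists e, x, z, y; split; first by move: t; rewrite /triangle; clear; lia.
    by move: le; rewrite !near3; clear; lia.
  rewrite leqNgt; apply/negP => lt; apply: dv2.
  apply/dvdpP; exists (drop_poly c1 P).
  rewrite -{1}(poly_take_drop c1 P) [take_poly _ _](_ : _ = 0) ?add0r //.
  apply/polyP => i; rewrite coef_take_poly coef0; case: ltnP => // ic.
  have [hi|hi] := leqP i (d + L).
    by apply: Pi => //; clear -lt hi; lia.
  rewrite nth_default // sP; move: v2 hi; clear; lia.
(* Without a positive gap, an apex at scale p^0 at distance 0 or 1, according to parity, is
   enough. *)
have [gap|gap] := leqP (c1 + c2 + L) (2 * (d + L)).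
  have [o|o] := boolP (odd (c1 + c2 + L)).
    exists 0, c1.-1, c2.-1, L.-1; rewrite near3 expn0 !mul1n /triangle /dist.
    clear -c1_0 c2_0 L0 gap o hL h1 h2; lia.
  exists 0, c1, c2.-1, L.-1; rewrite near3 expn0 !mul1n /triangle /dist.
  clear -c1_0 c2_0 L0 gap o hL h1 h2; lia.
have PE := poly_take_drop c1 P.
have A0 : drop_poly c1 P != 0.
  apply/negP => /eqP A0; move: PE; rewrite A0 mul0r addr0 => PE.
  have szP : (size P <= c1)%N by rewrite -PE size_take_poly.
  case/negP: Pn0; rewrite Pi ?eqxx //; move: szP; rewrite sP;
    by move: v1 v2 v3 sv0 L0; clear; move: (size v) => k; lia.
have B0 : take_poly c1 P != 0.
  apply/negP => /eqP B0; apply: dv2; apply/dvdpP.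
  by exists (drop_poly c1 P); rewrite -{1}PE B0 add0r.
apply: (syzygy_near_apex (A := drop_poly c1 P) (B := take_poly c1 P) (C := - v)).
- exact: A0.
- exact: B0.
- by rewrite oppr_eq0.
- by rewrite mulNr -/P -{3}PE [_ * _ + _]addrC subrr.
- have : (0 < size (drop_poly c1 P))%N by rewrite size_poly_gt0.
  by rewrite size_drop_poly sP; move: v2; clear; lia.
- have := lead_coef_eq0 (take_poly c1 P); rewrite (negPf B0) lead_coefE.
  have : (0 < size (take_poly c1 P))%N by rewrite size_poly_gt0.
  have := size_take_poly c1 P.
  move: (size (take_poly c1 P)) => k kc k0.
  rewrite coef_take_poly; case: ltnP => [ic|]; last by rewrite eqxx.
  move=> /negbT Pk0; rewrite leqNgt; apply/negP => lt; case/negP: (Pk0).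
  have kP : (k.-1 < size P)%N.
    by rewrite ltnNge; apply: contra Pk0 => ?; rewrite nth_default.
  rewrite Pi ?eqxx //; move: kP; rewrite sP; move: v2 lt k0; clear; lia.
- by rewrite size_polyN -addSn leq_add2r.
- by move: h1; clear; lia.
- by move: h2; clear; lia.
- by move: hL; clear; lia.
- exact: gap.
Qed.

End Syzygy.
End Polynomials.

(** * Kernel elements by induction on the number of variables *)

Definition box (c be : seq nat) : bool := all2 (fun b k => b < k) be c.

Fixpoint boxes (c : seq nat) : seq (seq nat) :=
  if c is k :: c' then [seq i :: be | i <- iota 0 k, be <- boxes c'] else [:: [::]].

Lemma mem_boxes c be : (be \in boxes c) = box c be.
Proof.
elim: c be => [|k c IH] [|b be] //=; rewrite /box /=.
  by apply/allpairsP => -[[i y] [_ _]].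
rewrite -/(box c be) -IH; apply/allpairsP/andP => [[[i y] /= [h1 h2 [-> ->]]]|[h1 h2]].
  by move: h1; rewrite mem_iota add0n.
by exists (b, be); rewrite /= mem_iota add0n.
Qed.

Lemma size_box c be : box c be -> size be = size c.
Proof. by elim: c be => [|k c IH] [|b be] //= /andP[_ /IH ->]. Qed.

Lemma all2_leq_box c be ga : all2 leq ga be -> box c be -> box c ga.
Proof.
elim: be ga c => [|b be IH] [|g ga] [|k c] //= /andP[h1 h2] /andP[h3 h4].
by apply/andP; split; [apply: leq_ltn_trans h3|apply: IH h4].
Qed.

Lemma all2_leq_refl be : all2 leq be be.
Proof. by elim: be => //= b be ->; rewrite leqnn. Qed.

Lemma all2_leq_trans be ga de : all2 leq ga be -> all2 leq be de -> all2 leq ga de.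
Proof.
elim: be ga de => [|b be IH] [|g ga] [|k c] //= /andP[h1 h2] /andP[h3 h4].
by rewrite (leq_trans h1 h3) IH.
Qed.


Section Kernel.
Local Open Scope ring_scope.
Variable K : fieldType.
Implicit Types (phi psi : seq nat -> K) (be ga c : seq nat).

(* A polynomial is given by its coefficient function on exponent lists; [mul_sum] is multiplication by the sum of the variables. *)
Fixpoint mul_sum phi be {struct be} : K :=
  if be is i :: be' then
    (if i is i'.+1 then phi (i' :: be') else 0) + mul_sum (fun ga => phi (i :: ga)) be'
  else 0.

Lemma mul_sum_ext phi psi be :
    (forall ga, all2 leq ga be -> (sumn ga).+1 = sumn be -> phi ga = psi ga) ->
  mul_sum phi be = mul_sum psi be.
Proof.
elim: be phi psi => [|i be IH] phi psi h //=; congr (_ + _).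
  by case: i h => //= i h; apply: h => /=; rewrite ?leqnSn ?all2_leq_refl.
by apply: IH => ga h1 h2; apply: h; rewrite /= ?leqnn // -addnS h2.
Qed.

Lemma mul_sum_lin (I : finType) (a : I -> K) (psi : I -> seq nat -> K) be :
  mul_sum (fun ga => \sum_k a k * psi k ga) be = \sum_k a k * mul_sum (psi k) be.
Proof.
elim: be psi => [|i be IH] psi /=.
  by rewrite big1 // => k _; rewrite mulr0.
rewrite IH; case: i => [|i].
  by rewrite add0r; apply: eq_bigr => k _; rewrite add0r.
by rewrite -big_split; apply: eq_bigr => k _; rewrite mulrDr.
Qed.

Lemma mul_sumZ a psi be : mul_sum (fun ga => a * psi ga) be = a * mul_sum psi be.
Proof.
elim: be psi => [|i be IH] psi /=; first by rewrite mulr0.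
by rewrite IH mulrDr; case: i => [|i] //; rewrite mulr0.
Qed.

Lemma mul_sum0 be : mul_sum (fun=> 0) be = 0.
Proof. by have := mul_sumZ 0 (fun=> 0) be; rewrite !mul0r. Qed.

Lemma iter_mul_sum_ext L phi psi be :
    (forall ga, all2 leq ga be -> (sumn ga + L)%N = sumn be -> phi ga = psi ga) ->
  iter L mul_sum phi be = iter L mul_sum psi be.
Proof.
elim: L be => [|L IH] be h /=.
  by apply: h; rewrite ?addn0 // all2_leq_refl.
apply: mul_sum_ext => ga h1 h2; apply: IH => de h3 h4; apply: h.
  exact: all2_leq_trans h3 h1.
by rewrite addnS h4.
Qed.

Lemma iter_mul_sum0 L phi be :
    (forall ga, all2 leq ga be -> (sumn ga + L)%N = sumn be -> phi ga = 0) ->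
  iter L mul_sum phi be = 0.
Proof.
move=> h; rewrite (@iter_mul_sum_ext L phi (fun=> 0)) // {h}.
elim: L be => //= L IH be; rewrite -[RHS](mul_sum0 be).
by apply: mul_sum_ext => ga _ _; apply: IH.
Qed.

Lemma iter_mul_sum_lin (I : finType) L (a : I -> K) (psi : I -> seq nat -> K) be :
  iter L mul_sum (fun ga => \sum_k a k * psi k ga) be =
  \sum_k a k * iter L mul_sum (psi k) be.
Proof.
elim: L be => //= L IH be; rewrite -mul_sum_lin.
by apply: mul_sum_ext => ga _ _; apply: IH.
Qed.

(** A nonzero form of degree d in A_c killed by the sum of the variables; only the values on the box
    matter. *)
Definition Kern c (d : nat) : Prop :=
  exists phi, [/\ forall be, box c be -> mul_sum phi be = 0,
    exists2 be, box c be & phi be != 0 &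
    forall be, box c be -> phi be != 0 -> sumn be = d].

Section Coordinates.
Variable c : seq nat.
Let N := size (boxes c).
Let box_seq (k : 'I_N) : seq nat := nth [::] (boxes c) k.

Definition coords phi : 'rV[K]_N := \row_k phi (box_seq k).
Definition unit_fun (k : 'I_N) : seq nat -> K := fun ga => (index ga (boxes c) == k)%:R.
Definition of_coords (u : 'rV[K]_N) : seq nat -> K := fun ga => \sum_k u 0 k * unit_fun k ga.
(** The image of the L-th power of the sum becomes a row space, and [cokermx] supplies the
    functionals that vanish on it. *)
Definition iter_mul_mx L : 'M[K]_N := \matrix_(k, l) iter L mul_sum (unit_fun k) (box_seq l).

Lemma box_box_seq k : box c (box_seq k).
Proof. by rewrite -mem_boxes mem_nth. Qed.

Lemma of_coordsK phi ga : box c ga -> of_coords (coords phi) ga = phi ga.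
Proof.
rewrite -mem_boxes => h; have h' := h; rewrite -index_mem in h'.
rewrite /of_coords (bigD1 (Ordinal h')) //= big1 ?addr0 => [|k].
  by rewrite /unit_fun eqxx mulr1 mxE /box_seq nth_index.
by rewrite /unit_fun -val_eqE eq_sym /= => /negPf->; rewrite mulr0.
Qed.

Lemma coords_eq phi psi : (forall ga, box c ga -> phi ga = psi ga) -> coords phi = coords psi.
Proof. by move=> h; apply/rowP => k; rewrite !mxE h // box_box_seq. Qed.

Lemma coords_inj phi psi ga : coords phi = coords psi -> box c ga -> phi ga = psi ga.
Proof. by move=> e h; rewrite -(of_coordsK phi h) e of_coordsK. Qed.

Lemma coords_iter_of L u : coords (iter L mul_sum (of_coords u)) = u *m iter_mul_mx L.
Proof.
apply/rowP => l; rewrite !mxE iter_mul_sum_lin.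
by apply: eq_bigr => k _; rewrite !mxE.
Qed.

Lemma coords_iter L phi : coords (iter L mul_sum phi) = coords phi *m iter_mul_mx L.
Proof.
rewrite -coords_iter_of; apply: coords_eq => ga h; apply: iter_mul_sum_ext => de h1 _.
by rewrite of_coordsK //; apply: all2_leq_box h.
Qed.

End Coordinates.

(* Splitting a kernel element along the first two variables: in its component of least degree [d1] in [x_1], [x_2], some coefficient is not in the image of [l''^L], with [L] least; it is then [l''^(L-1) w] with [l''^L w = 0], and a functional vanishing on the image of [l''^L] yields a form in [x_1], [x_2] killed by [(x_1 + x_2)^L]. *)
Lemma Kern_split (c1 c2 : nat) c d : Kern [:: c1, c2 & c] d ->
  exists d1 d2 L (v : {poly K}), [/\ d = (d1 + d2)%N, (0 < L)%N, Kern (L :: c) d2, v != 0 &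
     (forall i, v`_i != 0 -> [/\ i < c1, i <= d1 & d1 - i < c2]%N) /\
     (forall i, (i < c1)%N -> (i <= d1 + L)%N -> (d1 + L - i < c2)%N ->
       (v * ('X + 1) ^+ L)`_i = 0)].
Proof.
move=> [phi [ker [be0 bbe0 phibe0] deg]].
pose f i j := fun ga => phi (i :: j :: ga).
pose nz i j := has (fun ga => f i j ga != 0) (boxes c).
have nz0 i j ga : ~~ nz i j -> box c ga -> f i j ga = 0.
  by move=> /hasPn h; rewrite -mem_boxes => /h; rewrite negbK => /eqP.
pose P k := [exists i : 'I_c1, exists j : 'I_c2, (i + j == k)%N && nz i j].
have exP : exists k, P k.
  case: be0 bbe0 phibe0 => [//|i [|j ga]]; rewrite /box /= ?andbF //.
  move=> /and3P[hi hj hga] h; exists (i + j)%N.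
  apply/existsP; exists (Ordinal hi); apply/existsP; exists (Ordinal hj).
  by rewrite eqxx; apply/hasP; exists ga => //; rewrite mem_boxes.
case: (ex_minnP exP) => d1 Pd1 d1min.
have low i j ga : (i < c1)%N -> (j < c2)%N -> (i + j < d1)%N -> box c ga ->
    f i j ga = 0.
  move=> hi hj; rewrite ltnNge => h; apply: nz0; apply: contra h => h.
  apply: d1min; apply/existsP; exists (Ordinal hi); apply/existsP.
  by exists (Ordinal hj); rewrite eqxx.
(* The kernel equation at x_1^i x_2^j: l'' f_(i,j) = - f_(i-1,j) - f_(i,j-1). *)
have keq i j ga : (i < c1)%N -> (j < c2)%N -> box c ga ->
    mul_sum (f i j) ga = - (if i is i'.+1 then f i' j ga else 0)
                      - (if j is j'.+1 then f i j' ga else 0).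
  move=> hi hj h; have /= := ker (i :: j :: ga).
  rewrite /box /= hi hj => /(_ h) /eqP; rewrite addrA addrC addr_eq0 => /eqP ->.
  by rewrite opprD.
have degf i j ga : (i < c1)%N -> (j < c2)%N -> box c ga -> f i j ga != 0 ->
    (i + j + sumn ga)%N = d.
  by move=> hi hj h /(deg (i :: j :: ga)) /= <-; rewrite ?addnA // /box /= hi hj.
have d1d : (d1 <= d)%N.
  move: Pd1 => /existsP[i /existsP[j /andP[/eqP ij /hasP[ga]]]].
  rewrite mem_boxes => hga /(degf _ _ _ (ltn_ord i) (ltn_ord j) hga) <-.
  by rewrite ij leq_addr.
pose g := (d - d1)%N.
(* Some coefficient in degree [d1] lies outside the image of l''^l. For l = g + 1 this holds because
   such a coefficient has degree g. *)
pose Q l := [exists i : 'I_c1, exists j : 'I_c2,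
   (i + j == d1)%N && ~~ (coords c (f i j) <= iter_mul_mx c l)%MS].
have exQ : exists l, Q l.
  exists g.+1; move: Pd1 => /existsP[i /existsP[j /andP[/eqP ij /hasP[ga]]]].
  rewrite mem_boxes => hga fga; apply/existsP; exists i; apply/existsP; exists j.
  rewrite ij eqxx; apply: contra (fga) => /submxP[u].
  rewrite -coords_iter_of => /coords_inj /(_ hga) ->; rewrite iter_mul_sum0 // => de _.
  move: fga => /(degf _ _ _ (ltn_ord i) (ltn_ord j) hga).
  by rewrite ij /g; clear; lia.
case: (ex_minnP exQ) => L QL Lmin.
move: QL => /existsP[i2 /existsP[j2 /andP[/eqP ij2 nim]]].
(* Since l''^0 is onto, the least exponent is positive; from here on it is [L.+1], and [f i2 j2]
   lies in the image of l''^L. *)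
case: L Lmin nim => [|L] Lmin nim.
  by case/negP: nim; have /= -> := coords_iter c 0 (f i2 j2); apply: submxMl.
have /submxP[u] : (coords c (f i2 j2) <= iter_mul_mx c L)%MS.
  apply/negPn/negP => h; suff : (L < L)%N by rewrite ltnn.
  apply: Lmin.
  by apply/existsP; exists i2; apply/existsP; exists j2; rewrite ij2 eqxx.
rewrite -coords_iter_of => /coords_inj fE.
have hi2 := ltn_ord i2; have hj2 := ltn_ord j2.
have [ga2 hga2 fga2] : exists2 ga, box c ga & f i2 j2 ga != 0.
  have [/hasP[ga]|/nz0 h] := boolP (nz i2 j2).
    by rewrite mem_boxes => *; exists ga.
  case/negP: nim; rewrite (_ : coords _ _ = 0) ?sub0mx //.
  by apply/rowP => k; rewrite !mxE h // box_box_seq.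
have Lg : (L <= g)%N.
  rewrite leqNgt; apply: contra (fga2) => lt; rewrite fE // iter_mul_sum0 // => de _.
  move: (degf _ _ _ hi2 hj2 hga2 fga2).
  by rewrite ij2 /g in lt *; clear -lt d1d; lia.
(* The component of degree g - L of the preimage, which still maps to the homogeneous [f i2 j2]. *)
pose psi ga := if sumn ga == (g - L)%N then of_coords u ga else 0.
have psi_iter k ga : iter k mul_sum psi ga != 0 -> sumn ga = (g - L + k)%N.
  move=> h; apply/eqP; apply: contraNT h => h; rewrite iter_mul_sum0 // => de _ e.
  rewrite /psi; case: eqP => // e2; case/eqP: h; by rewrite -e e2.
have psiE ga : box c ga -> iter L mul_sum psi ga = f i2 j2 ga.
  move=> hga; have [e|ne] := eqVneq (sumn ga) g.
    rewrite fE //; apply: iter_mul_sum_ext => de _ e2; rewrite /psi ifT //.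
    by rewrite -e -e2 addnK.
  have [-> |/(degf _ _ _ hi2 hj2 hga)] := eqVneq (f i2 j2 ga) 0.
    apply/eqP; apply: contraNT ne => /psi_iter ->; by rewrite subnK.
  by rewrite ij2 => e; case/eqP: ne; rewrite /g -e addKn.
exists d1, g, L.+1.
(* Apply l''^k, then a functional vanishing on the image of l''^(L+1); [k0] is chosen so that it
   does not vanish at [f i2 j2]. *)
pose Y k (w : 'rV_(size (boxes c))) k0 := (w *m iter_mul_mx c k *m cokermx (iter_mul_mx c L.+1)) 0 k0.
have [k0 k0P] : exists k0, (coords c (f i2 j2) *m cokermx (iter_mul_mx c L.+1)) 0 k0 != 0.
  by apply/rV0Pn; rewrite -submxE.
have Y0 h : Y 0 (coords c h) k0 = (coords c h *m cokermx (iter_mul_mx c L.+1)) 0 k0.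
  by rewrite /Y -coords_iter.
have YS k h : Y k (coords c (mul_sum h)) k0 = Y k.+1 (coords c h) k0.
  by rewrite /Y -!coords_iter iterSr.
pose v : {poly K} := \poly_(i < d1.+1)
  (if (i < c1)%N && (d1 - i < c2)%N then Y 0%N (coords c (f i (d1 - i)%N)) k0 else 0).
exists v; split.
- by rewrite subnKC.
- by [].
(* With t the new variable, [chi] is the sum of (-t)^i l''^(L-i) psi. Multiplication by t + l''
   telescopes to l''^(L+1) psi = l'' [f i2 j2], which is 0 by minimality of [d1]. *)
- pose chi be := if be is i :: ga then (-1) ^+ i * iter (L - i) mul_sum psi ga else 0.
  exists chi; split.
  + case=> [//|i ga]; rewrite /box /= ltnS => /andP[hi hga].
    case: i hi => [|i] hi /=.
      rewrite add0r subn0 (@mul_sum_ext _ (f i2 j2)); last first.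
        move=> de h _; rewrite expr0 mul1r psiE //; exact: all2_leq_box hga.
      rewrite keq //; move: hi2 hj2 ij2.
      case: (nat_of_ord i2) (nat_of_ord j2) => [|i] [|j] hi2' hj2' ij; rewrite ?oppr0 ?addr0 ?add0r ?low ?oppr0 ?addr0 //;
      by move: ij hi2' hj2'; clear; lia.
    rewrite mul_sumZ -iterS subnSK // exprS mulN1r mulNr.
    by rewrite subrr.
  + have [/hasP[de]|/hasPn h] := boolP (has (fun de => psi de != 0) (boxes c)).
      rewrite mem_boxes => hde hpsi; exists (L :: de); first by rewrite /box /= ltnSn.
      by rewrite /= subnn /= mulf_neq0 // signr_eq0.
    case/negP: fga2; rewrite -psiE // iter_mul_sum0 // => de hde _.
    by apply/eqP/negbNE/h; rewrite mem_boxes; apply: all2_leq_box hga2.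
  + case=> [//|i ga]; rewrite /box /= ltnS => /andP[hi hga].
    rewrite mulf_eq0 negb_or => /andP[_ /psi_iter ->].
    by clear -hi Lg; lia.
- apply: contra_neq k0P => v0; have := congr1 (fun q : {poly K} => q`_i2) v0.
  rewrite coef_poly coef0 -ij2 ltnS leq_addr addKn hi2 hj2 /= Y0 => ->.
  by [].
split.
- move=> i; rewrite coef_poly; case: ltnP; rewrite ?eqxx // ltnS => h.
  by case: andP => [[h1 h2] _|]; rewrite ?eqxx.
have sZ : size ('X + 1 : {poly K}) = 2 by rewrite -polyC1 size_XaddC.
have sv k : (size (v * ('X + 1) ^+ k)%R <= d1 + k.+1)%N.
  elim: k => [|k IH]; first by rewrite expr0 mulr1 addn1 size_poly.
  rewrite exprSr mulrA; apply: leq_trans (size_polyMleq _ _) _.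
  by rewrite sZ addn2 addnS ltnS.
(* By [keq], multiplying v by x_1 + x_2 amounts, up to sign, to applying l'' inside the
   functional. *)
have main k i : (i < c1)%N -> (i <= d1 + k)%N -> (d1 + k - i < c2)%N ->
    (v * ('X + 1) ^+ k)`_i = (-1) ^+ k * Y k (coords c (f i (d1 + k - i)%N)) k0.
  elim: k i => [|k IH] i h1 h2 h3.
    by rewrite expr0 mul1r mulr1 coef_poly; rewrite addn0 in h2 h3 *; rewrite ltnS h2 h1 h3.
  rewrite exprSr mulrA mulrDr mulr1 coefD coefMX -YS.
  pose j := (d1 + k.+1 - i)%N; rewrite -/j in h3 *.
  have -> : coords c (mul_sum (f i j)) =
     - (if i is i'.+1 then coords c (f i' j) else 0) - (if j is j'.+1 then coords c (f i j') else 0).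
    apply/rowP => l; rewrite !mxE keq ?box_box_seq //.
    by case: (i) (j) => [|i'] [|j']; rewrite !mxE.
  have YN A B : Y k (- A - B) k0 = - (Y k A k0 + Y k B k0).
    by rewrite /Y -opprD mulNmx mulNmx !mulmxDl !mxE.
  have Y00 : Y k 0 k0 = 0 by rewrite /Y !mul0mx mxE.
  rewrite YN exprS mulN1r mulrNN mulrDr; congr (_ + _).
    rewrite {}/j in h3 *; case: i h1 h2 h3 => [|i] h1 h2 h3 /=.
      by rewrite Y00 mulr0.
    rewrite IH ?(ltnW h1) //; first by rewrite addnS subSS.
    - by rewrite -ltnS -addnS.
    - by rewrite addnS subSS in h3.
  move: h3; rewrite /j; have [h3|h3] := leqP i (d1 + k).
    by rewrite addnS subSn // => h; apply: IH => //; apply: ltnW.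
  rewrite (_ : _ - i = 0)%N; last by move: h2 h3; clear; lia.
  by rewrite Y00 mulr0 nth_default // (leq_trans (sv k)) // addnS.
by move=> i h1 h2 h3; rewrite main // /Y -mulmxA mulmx_coker mulmx0 mxE mulr0.
Qed.

(** Neighbouring coefficients on the antidiagonal of degree d are opposite; if the antidiagonal
    ended strictly inside the box, the coefficient at that end, and so all of them, would vanish. *)
Lemma Kern2_leq (c1 c2 : nat) d : Kern [:: c1; c2] d -> (c1 <= d.+1)%N /\ (c2 <= d.+1)%N.
Proof.
move=> [phi [ker [be bbe nz] deg]].
have deg' i j : (i < c1)%N -> (j < c2)%N -> phi [:: i; j] != 0 -> (i + j)%N = d.
  move=> hi hj /(deg [:: i; j]) /=; rewrite /box /= hi hj addn0; exact.
case: be bbe nz => [|i [|j [|? ?]]] //=; rewrite /box /= ?andbT ?andbF //.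
move=> /andP[hi hj] nz; split; rewrite leqNgt; apply: contra nz => lt; apply/eqP.
  elim: j i hj hi => [|j IH] i hj hi; apply/eqP; apply: contraTT lt => nz.
    have := deg' _ _ hi hj nz; rewrite addn0 => e; rewrite -leqNgt -e.
    rewrite leqNgt; apply: contra nz => lt.
    by have := ker [:: i.+1; 0%N]; rewrite /box /= lt hj /= !addr0 => /(_ isT) ->.
  have e := deg' _ _ hi hj nz; rewrite -leqNgt leqNgt; apply: contra nz => lt.
  have hi' : (i.+1 < c1)%N by move: lt e; clear; lia.
  have := ker [:: i.+1; j.+1]; rewrite /box /= hi' hj => /(_ isT).
  by rewrite (IH i.+1) ?(ltnW hj) // add0r addr0 => /eqP.
elim: i j hj hi => [|i IH] j hj hi; apply/eqP; apply: contraTT lt => nz.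
  have := deg' _ _ hi hj nz; rewrite add0n => e; rewrite -leqNgt -e.
  rewrite leqNgt; apply: contra nz => lt.
  have := ker [:: 0%N; j.+1]; rewrite /box /= lt hi /= => /(_ isT).
  by rewrite add0r addr0 => ->.
have e := deg' _ _ hi hj nz; rewrite -leqNgt leqNgt; apply: contra nz => lt.
have hj' : (j.+1 < c2)%N by move: lt e; clear; lia.
have := ker [:: i.+1; j.+1]; rewrite /box /= hj' hi => /(_ isT).
by rewrite (IH j.+1) ?(ltnW hi) // add0r !addr0 => /eqP.
Qed.

Lemma Kern_near p c d : p \in [pchar K] -> all (leq 1) c -> (1 < size c)%N ->
    Kern c d ->
  exists e b bs, [/\ fan b bs, (size bs).+1 = size c &
    (sumn c + near (p ^ e) c (b :: bs) <=
       (size c - 2) * (p ^ e).-1 + 2 * d + size c)%N].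
Proof.
move=> hp; have p0 := prime_gt0 (pcharf_prime hp).
have [n] := ubnP (size c); elim: n c d => // n IH.
case=> [|c1 [|c2 [|c3 c]]] d //; rewrite ltnS.
  (* In two variables the radius term vanishes, and at scale p^0 the claim says that the larger
     exponent is at most d + 1. *)
  move=> _ /= /and3P[c10 c20 _] _ /Kern2_leq[h1 h2].
  exists 0%N, (minn c1 c2).-1, [:: (minn c1 c2).-1]; split=> //=.
    by exists 0%N => //; rewrite /triangle; clear; lia.
  rewrite !near_cons /near /= dists0 expn0 !mul1n /dist.
  by move: c10 c20 h1 h2; clear; lia.
set c' := c3 :: c => sz ac _ /Kern_split.
move=> [d1 [d2 [L [v [dE L0 kerL v0 [vi vP]]]]]].
have /and3P[c10 c20 ac'] := ac.
have [e1 [a1 [a2 [al [ta le1]]]]] := pair_near_apex hp c10 c20 L0 v0 vi vP.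
have [||||e2 [b [bs [gb sb le2]]]] := IH (L :: c') d2.
- by move: sz; rewrite /=; clear; lia.
- by rewrite /= L0.
- by [].
- exact: kerL.
have sb' : size bs = size c' by case: sb.
have [e [x [xs [gx sx le]]]] := glue e1 e2 c1 c2 L p0 (isT : c' != [::]) ta gb sb'.
exists e, x, xs; split; rewrite ?sx //.
have pe1 : (0 < p ^ e1)%N by rewrite expn_gt0 p0.
move: le le1 le2; rewrite dE.
rewrite -[size [:: _, _ & _]]/(size c').+2 -[size (L :: c')]/(size c').+1.
rewrite -[sumn [:: _, _ & _]]/(c1 + (c2 + sumn c'))%N -[sumn (L :: _)]/(L + sumn c')%N.
rewrite subSS subn1 !subSS subn0.
move: (near _ [:: _, _ & _] _) (near (p ^ e1) _ _) (near (p ^ e2) _ _) => n1 n2 n3.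
set m1 := ((size c').-1 * _)%N; set m2 := (size c' * _)%N; move: m1 m2.
by move: pe1; clear; lia.
Qed.

End Kernel.

(** * Monomial complete intersections *)


Section Exponents.
Local Open Scope ring_scope.
Variable n : nat.
Implicit Types (m : 'X_{1..n}) (k : 'I_n -> nat).

Definition below k m : bool := [forall i, m i < k i]%N.
Definition ord_seq (T : Type) (f : 'I_n -> T) : seq T := [seq f i | i <- enum 'I_n].
Definition mnm_of_seq (be : seq nat) : 'X_{1..n} := [multinom nth 0%N be i | i < n].

Lemma size_ord_seq T (f : 'I_n -> T) : size (ord_seq f) = n.
Proof. by rewrite size_map size_enum_ord. Qed.

Lemma nth_ord_seq T (f : 'I_n -> T) x0 (i : 'I_n) : nth x0 (ord_seq f) i = f i.
Proof. by rewrite (nth_map i) ?size_enum_ord // nth_ord_enum. Qed.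

Lemma ord_seqK m : mnm_of_seq (ord_seq m) = m.
Proof. by apply/mnmP => i; rewrite mnmE nth_ord_seq. Qed.

Lemma mnm_of_seqK be : size be = n -> ord_seq (mnm_of_seq be) = be.
Proof.
move=> sz; apply: (@eq_from_nth _ 0%N); rewrite size_ord_seq // => i hi.
by rewrite (nth_ord_seq _ _ (Ordinal hi)) mnmE.
Qed.

Lemma sumn_ord_seq k : sumn (ord_seq k) = (\sum_i k i)%N.
Proof. by rewrite sumnE big_map big_enum. Qed.

Lemma box_ord_seq k m : box (ord_seq k) (ord_seq m) = below k m.
Proof.
rewrite /box /ord_seq /below; have -> : [forall i, m i < k i]%N = all (fun i => m i < k i)%N (enum 'I_n).
  by apply/forallP/allP => [h i _|h i]; [exact: h|apply: h; rewrite mem_enum].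
by elim: (enum _) => //= i s ->.
Qed.

Lemma boxes_uniq c : uniq (boxes c).
Proof.
elim: c => //= k c IH; apply: allpairs_uniq; rewrite ?iota_uniq //.
by move=> [? ?] [? ?] _ _ /= [-> ->].
Qed.

Definition mons k d : seq 'X_{1..n} :=
  [seq mnm_of_seq be | be <- [seq be <- boxes (ord_seq k) | sumn be == d]].

Lemma mons_uniq k d : uniq (mons k d).
Proof.
rewrite map_inj_in_uniq ?filter_uniq ?boxes_uniq // => x y.
rewrite !mem_filter !mem_boxes => /andP[_ /size_box hx] /andP[_ /size_box hy].
by rewrite size_ord_seq in hx hy; move/(congr1 (fun m : 'X_{1..n} => ord_seq m)); rewrite !mnm_of_seqK.
Qed.

Lemma mem_mons k d m : (m \in mons k d) = below k m && (mdeg m == d).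
Proof.
rewrite -box_ord_seq mdegE -sumn_ord_seq; apply/mapP/andP => [[be]|[h1 h2]].
  rewrite mem_filter mem_boxes => /andP[h1 h2] ->.
  by rewrite mnm_of_seqK // (size_box h2) size_ord_seq.
exists (ord_seq m); last by rewrite ord_seqK.
by rewrite mem_filter mem_boxes h1 h2.
Qed.

End Exponents.

(** * Standard monomials, socle duality and the WLP *)

Section MonomialIdeal.
Local Open Scope classical_set_scope.
Local Open Scope ring_scope.
Local Open Scope quotient_scope.
Variables (K : fieldType) (n : nat) (c : expvec n).
Implicit Types (f g lp : {mpoly K[n]}) (m : 'X_{1..n}).

Definition expo (i : 'I_n) : nat := absz (c 0 i).

Definition standard m : bool := below expo m.

Lemma expo_ge2 i : (2 <= expo i)%N.
Proof. have := expvecP c i; rewrite /expo; lia. Qed.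

Lemma expo_gt0 i : (0 < expo i)%N.
Proof. exact: ltnW (expo_ge2 i). Qed.

Lemma mcoeffMX_notle (f : {mpoly K[n]}) (k m : 'X_{1..n}) (i : 'I_n) :
  (m i < k i)%N -> (f * 'X_[k])@_m = 0.
Proof.
move=> lt; rewrite (mpolyE f) mulr_suml raddf_sum /= big1 // => m' _.
rewrite -scalerAl -mpolyXD mcoeffZ mcoeffX.
case: eqP => [e|_]; last by rewrite mulr0.
by move: lt; rewrite -e mnmDE ltnNge leq_addl.
Qed.

Lemma ci_idealP f : (f \in ci_ideal (K := K) c) <-> (forall m, standard m -> f@_m = 0).
Proof.
split.
  move=> /asboolP [g ->] m /forallP h; rewrite raddf_sum /= big1 // => i _.
  rewrite mpolyXn; apply: (@mcoeffMX_notle _ _ _ i).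
  by rewrite mulmnE mnm1E eqxx mul1n; apply: h.
move=> h; rewrite (mpolyE f); rewrite big_seq; apply: rpred_sum => m mf.
have /forallPn[i] : ~~ standard m by apply: contraL mf => /h; rewrite -mcoeff_eq0 => ->.
rewrite -leqNgt => le; rewrite -mul_mpolyC; apply: idealMr.
have -> : m = (m - U_(i) *+ expo i + U_(i) *+ expo i)%MM.
  rewrite submK //; apply/mnm_lepP => j; rewrite mulmnE mnm1E.
  by case: eqP => [<-|]; rewrite ?mul1n ?mul0n.
rewrite mpolyXD; apply: idealMr; apply/asboolP.
exists (fun j => (j == i)%:R); rewrite (bigD1 i) //= big1 ?addr0 => [|j /negPf->].
  by rewrite eqxx mul1r -mpolyXn.
by rewrite mul0r.
Qed.

Lemma pi_eq f g : (\pi_(ci_algebra K c) f = \pi_(ci_algebra K c) g) <->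
  (f - g \in ci_ideal (K := K) c).
Proof. by rewrite Quotient.idealrBE; split=> [->|/eqP]. Qed.

(** Injectivity and surjectivity in degree d, lifted from the quotient to polynomials. *)
Definition Inj lp d := forall f, f \is d.-homog ->
  lp * f \in ci_ideal (K := K) c -> f \in ci_ideal (K := K) c.
Definition Surj lp d := forall g, g \is d.+1.-homog ->
  exists2 f, f \is d.-homog & lp * f - g \in ci_ideal (K := K) c.

Lemma max_rankP lp d : lp \is 1.-homog ->
  max_rank (\pi_(ci_algebra K c) lp) d <-> Inj lp d \/ Surj lp d.
Proof.
move=> hlp; split=> [[h|h]|[h|h]].
- left=> f hf lf; have : \pi_(ci_algebra K c) f = \pi_(ci_algebra K c) 0.
    apply: h; rewrite ?inE; [by exists f|by exists 0 => //; exact: dhomog0|].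
    by rewrite -!rmorphM; apply/pi_eq; rewrite mulr0 subr0.
  by move/pi_eq; rewrite subr0.
- right=> g hg; have : @ci_piece K n c d.+1 (\pi_(ci_algebra K c) g) by exists g.
  rewrite -h => -[x [f hf <-]]; rewrite -rmorphM => /pi_eq e.
  by exists f.
- left=> x y; rewrite !inE => -[f hf <-] [g hg <-].
  rewrite -!rmorphM => /pi_eq; rewrite -mulrBr => e; apply/pi_eq; apply: h => //.
  by rewrite rpredB.
right; apply/seteqP; split=> x.
  move=> [y [f hf <-] <-]; rewrite -rmorphM; exists (lp * f) => //=.
  by rewrite -add1n; apply: dhomogM.
move=> [g /h [f hf e] <-]; exists (\pi_(ci_algebra K c) f); first by exists f.
by rewrite -rmorphM; apply/pi_eq.
Qed.

Lemma WLP_P : WLP K c <-> exists2 lp, lp \is 1.-homog & forall d, Inj lp d \/ Surj lp d.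
Proof.
split=> [[l [lp hlp <-] h]|[lp hlp h]].
  by exists lp => // d; apply/(max_rankP _ hlp).
exists (\pi_(ci_algebra K c) lp); first by exists lp.
by move=> d; apply/(max_rankP _ hlp).
Qed.

Definition sum_vars : {mpoly K[n]} := \sum_(i < n) 'X_i.

Lemma sum_vars_homog : sum_vars \is 1.-homog.
Proof. by apply: rpred_sum => i _; rewrite dhomogX /= mdeg1. Qed.

Lemma mcoeff_XM (i : 'I_n) f m :
  ('X_i * f)@_m = if (0 < m i)%N then f@_(m - U_(i))%MM else 0.
Proof.
rewrite mulrC; case: ltnP => h; last first.
  by apply: (@mcoeffMX_notle _ _ _ i); rewrite mnm1E eqxx; apply: leq_ltn_trans h _.
rewrite -{1}(submK (m := U_(i)%MM) (m' := m)) 1?addmC ?mcoeffMX //.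
by apply/mnm_lepP => j; rewrite mnm1E; case: eqP => // <-.
Qed.

Lemma mul_sumE (phi : seq nat -> K) be :
  mul_sum phi be =
  \sum_(i < size be) if (0 < nth 0 be i)%N
                     then phi (set_nth 0%N be i (nth 0 be i).-1) else 0.
Proof.
elim: be phi => [|b be IH] phi /=; first by rewrite big_ord0.
rewrite big_ord_recl /= IH; congr (_ + _); first by case: b.
Qed.

Lemma mul_sum_mcoeff f be : size be = n ->
  mul_sum (fun ga => f@_(mnm_of_seq n ga)) be = (sum_vars * f)@_(mnm_of_seq n be).
Proof.
move=> sz; rewrite mul_sumE /sum_vars mulr_suml raddf_sum /= sz.
apply: eq_bigr => i _; rewrite mcoeff_XM mnmE; case: ifP => // h.
congr (f@__); apply/mnmP => j; rewrite mnmE mnmBE mnmE mnm1E nth_set_nth /= -subn1.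
by rewrite -val_eqE /= eq_sym; case: eqP => [->|]; rewrite ?subn0.
Qed.

Lemma Kern_of f d : f \is d.-homog -> sum_vars * f \in ci_ideal (K := K) c ->
  f \notin ci_ideal (K := K) c -> Kern K (ord_seq expo) d.
Proof.
move=> hf /ci_idealP lf nf.
have bm be : box (ord_seq expo) be -> size be = n /\ standard (mnm_of_seq n be).
  move=> h; have sz : size be = n by rewrite (size_box h) size_ord_seq.
  by rewrite /standard -box_ord_seq mnm_of_seqK.
exists (fun ga => f@_(mnm_of_seq n ga)); split.
- by move=> be /bm[sz h]; rewrite mul_sum_mcoeff ?lf.
- apply: contrapT => h; case/negP: nf; apply/ci_idealP => m hm.
  apply/eqP/negPn/negP => nz; apply: h; exists (ord_seq m).
    by rewrite box_ord_seq.
  by rewrite ord_seqK.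
move=> be /bm[sz h] nz; rewrite -(mnm_of_seqK sz) sumn_ord_seq -mdegE.
by apply/eqP; apply: contraNT nz => /(dhomog_nemf_coeff hf) ->.
Qed.

Definition socdeg : nat := \sum_i (expo i).-1.
Definition soc : 'X_{1..n} := [multinom (expo i).-1 | i < n].

Lemma standard_soc m : standard m = (m <= soc)%MM.
Proof.
apply/forallP/mnm_lepP => h i; have := h i; have := expo_gt0 i; rewrite mnmE; lia.
Qed.

Lemma mdeg_soc : mdeg soc = socdeg.
Proof. by rewrite mdegE; apply: eq_bigr => i _; rewrite mnmE. Qed.

Lemma mdeg_socB m : standard m -> (mdeg (soc - m)%MM + mdeg m = socdeg)%N.
Proof. by rewrite standard_soc => h; rewrite -mdegD submK // mdeg_soc. Qed.

Lemma standard_socB m : standard (soc - m)%MM.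
Proof. by rewrite standard_soc; apply/mnm_lepP => i; rewrite mnmBE leq_subr. Qed.

Lemma socBK m : standard m -> (soc - (soc - m))%MM = m.
Proof.
rewrite standard_soc => /mnm_lepP h; apply/mnmP => i; rewrite !mnmBE subKn //.
Qed.

Lemma mcoeff_sum_varsX m m' : (sum_vars * 'X_[m])@_m' = \sum_i ((U_(i) + m)%MM == m')%:R.
Proof.
rewrite /sum_vars mulr_suml raddf_sum /=; apply: eq_bigr => i _.
by rewrite -mpolyXD mcoeffX.
Qed.

Lemma mcoeff_sum_vars_dual m m' : standard m -> standard m' ->
  (sum_vars * 'X_[(soc - m')%MM])@_(soc - m)%MM = (sum_vars * 'X_[m])@_m'.
Proof.
rewrite !standard_soc => /mnm_lepP h /mnm_lepP h'; rewrite !mcoeff_sum_varsX.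
apply: eq_bigr => i _; congr (nat_of_bool _)%:R.
by apply/eqP/eqP => /mnmP e; apply/mnmP => j; have := e j; have := h j; have := h' j;
  rewrite !mnmE; lia.
Qed.

(** Under m -> soc - m the matrices of multiplication in degrees d and e are transposes of each
    other. *)
Lemma Surj_of_Inj d e : (d.+1 + e)%N = socdeg -> Inj sum_vars e -> Surj sum_vars d.
Proof.
move=> de inj.
pose A := mons expo d; pose B := mons expo d.+1.
pose a (k : 'I_(size A)) := nth 0%MM A k; pose b (l : 'I_(size B)) := nth 0%MM B l.
have ha k : standard (a k) /\ mdeg (a k) = d.
  by have := mem_nth 0%MM (ltn_ord k); rewrite mem_mons => /andP[? /eqP ?]; split.
have hb l : standard (b l) /\ mdeg (b l) = d.+1.
  by have := mem_nth 0%MM (ltn_ord l); rewrite mem_mons => /andP[? /eqP ?]; split.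
pose M : 'M[K]_(size A, size B) := \matrix_(k, l) (sum_vars * 'X_[a k])@_(b l).
have full : row_full M.
  rewrite /row_full -mxrank_tr; apply: inj_row_free => z zM.
  pose f : {mpoly K[n]} := \sum_l z 0 l *: 'X_[(soc - b l)%MM].
  have hf : f \is e.-homog.
    apply: rpred_sum => l _; apply: dhomogZ; rewrite dhomogX /=.
    have [/mdeg_socB h1 h2] := hb l.
    by move: h1; rewrite -de h2 addnC => /addnI ->.
  have fI : f \in ci_ideal (K := K) c.
    apply: inj => //; apply/ci_idealP => m hm.
    have hlf : sum_vars * f \is (e.+1).-homog.
      by rewrite -add1n; apply: dhomogM hf; exact: sum_vars_homog.
    have [me|/(dhomog_nemf_coeff hlf)//] := eqVneq (mdeg m) e.+1.
    have : (soc - m)%MM \in A.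
      rewrite mem_mons -/(standard _) standard_socB /=; apply/eqP.
      by have := mdeg_socB hm; rewrite me -de; lia.
    move=> /(nthP 0%MM)[k hk ak].
    have -> : m = (soc - a (Ordinal hk))%MM by rewrite /a ak socBK.
    move/matrixP/(_ 0 (Ordinal hk)): zM; rewrite !mxE => <-.
    rewrite mulr_sumr raddf_sum /=; apply: eq_bigr => l _.
    rewrite -scalerAr mcoeffZ !mxE mcoeff_sum_vars_dual //; first by case: (ha (Ordinal hk)).
    by case: (hb l).
  apply/rowP => l; rewrite mxE.
  have := (ci_idealP f).1 fI (soc - b l)%MM (standard_socB _).
  rewrite raddf_sum /= (bigD1 l) //= mcoeffZ mcoeffX eqxx mulr1 big1 ?addr0 //.
  move=> l' ne; rewrite mcoeffZ mcoeffX; case: eqP => [e'|]; last by rewrite mulr0.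
  case/eqP: ne; apply/val_inj/eqP; rewrite /= -(nth_uniq 0%MM _ _ (mons_uniq expo d.+1)) //.
  have [h1 _] := hb l; have [h2 _] := hb l'.
  by apply/eqP; rewrite -[LHS](socBK h2) -[RHS](socBK h1) -/(b l) -e'.
move=> g hg; have /submxP[u uE] := submx_full (\row_l g@_(b l)) full.
exists (\sum_k u 0 k *: 'X_[a k]).
  apply: rpred_sum => k _; apply: dhomogZ; rewrite dhomogX /=.
  by have [_ ->] := ha k.
apply/ci_idealP => m hm; rewrite mcoeffB; apply/eqP; rewrite subr_eq0; apply/eqP.
have hlf : sum_vars * (\sum_k u 0 k *: 'X_[a k]) \is (d.+1).-homog.
  rewrite -[d.+1]add1n; apply: dhomogM; first exact: sum_vars_homog.
  apply: rpred_sum => k _; apply: dhomogZ; rewrite dhomogX /=.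
  by have [_ ->] := ha k.
have [md|ne] := eqVneq (mdeg m) d.+1; last first.
  by rewrite (dhomog_nemf_coeff hlf ne) (dhomog_nemf_coeff hg ne).
have : m \in B by rewrite mem_mons md eqxx andbT.
move=> /(nthP 0%MM)[l hl bl].
have -> : m = b (Ordinal hl) by rewrite /b bl.
move/matrixP/(_ 0 (Ordinal hl)): uE; rewrite !mxE => ->.
rewrite mulr_sumr raddf_sum /=; apply: eq_bigr => k _.
by rewrite -scalerAr mcoeffZ !mxE.
Qed.

(** In degrees d with 2 d >= s duality yields surjectivity, as the dual degree s - d - 1 is below s
    / 2; beyond s the target is zero. *)
Lemma WLP_of_Inj : (forall d, (2 * d < socdeg)%N -> Inj sum_vars d) -> WLP K c.
Proof.
move=> inj; apply/WLP_P; exists sum_vars; first exact: sum_vars_homog.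
move=> d; have [h|h] := ltnP (2 * d) socdeg; first by left; apply: inj.
right; have [hs|hs] := ltnP d socdeg.
  apply: (@Surj_of_Inj d (socdeg - d.+1)); first by rewrite subnKC.
  by apply: inj; move: h hs; clear; lia.
move=> g hg; exists 0; first exact: dhomog0.
apply/ci_idealP => m hm; rewrite mulr0 sub0r mcoeffN (dhomog_nemf_coeff hg) ?oppr0 //.
by rewrite neq_ltn /=; have := mdeg_socB hm; move: hs; clear; lia.
Qed.

End MonomialIdeal.

(** * Failure of the WLP near an apex *)


Section Counting.
Local Open Scope ring_scope.

(** The coefficient of t^z in the product of the 1 + t + ... + t^(c_i - 1); an integer z avoids
    truncation in recursion and symmetry. *)
Definition num_seq (c : seq nat) (z : int) : nat :=
  (\sum_(be <- boxes c) (z == (sumn be)%:Z))%N.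

Lemma num_seq_cons k c z : num_seq (k :: c) z = (\sum_(i < k) num_seq c (z - i%:Z))%N.
Proof.
rewrite /num_seq big_allpairs_dep /= -{1}[k]subn0 -/(index_iota 0 k) big_mkord.
apply: eq_bigr => i _; apply: eq_bigr => be _.
by rewrite PoszD addrC subr_eq.
Qed.

Lemma num_seq_nil z : num_seq [::] z = (z == 0).
Proof. by rewrite /num_seq /= big_seq1. Qed.

Lemma num_seq_sym b z : num_seq (map succn b) ((sumn b)%:Z - z) = num_seq (map succn b) z.
Proof.
elim: b z => [|k b IH] z; first by rewrite !num_seq_nil sub0r oppr_eq0.
rewrite /= !num_seq_cons (reindex_inj rev_ord_inj); apply: eq_bigr => i _ /=.
rewrite -IH; congr num_seq; have := ltn_ord i; lia.
Qed.

Lemma num_seq_diff k c z :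
  (num_seq (k.+1 :: c) z + num_seq c (z - k.+1%:Z) = num_seq (k.+1 :: c) (z - 1) + num_seq c z)%N.
Proof.
rewrite !num_seq_cons big_ord_recl big_ord_recr /= subr0.
rewrite (_ : z - 1 - k%:Z = z - k.+1%:Z); last by lia.
have -> : (\sum_(i < k) num_seq c (z - (bump 0 i)%:Z) = \sum_(i < k) num_seq c (z - 1 - i%:Z))%N.
  by apply: eq_bigr => i _; congr num_seq; rewrite /bump /=; lia.
by move: (\sum_(i < k) _)%N (num_seq c _) (num_seq c _); clear; lia.
Qed.

(** By [num_seq_diff] the increment at j is a difference of two values for the shorter list.
    Reflection brings the first to the lower half, where induction compares them. *)
Lemma num_seq_unimodal b :
  (forall j : int, 2 * j <= (sumn b)%:Z ->
     (num_seq (map succn b) (j - 1) <= num_seq (map succn b) j)%N) /\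
  (forall j : int, 0 <= j -> 2 * j <= (sumn b)%:Z ->
     (forall x, x \in b -> x%:Z <= (sumn b)%:Z - j) ->
     (num_seq (map succn b) (j - 1) < num_seq (map succn b) j)%N).
Proof.
elim: b => [|k b [weak strict]].
  split=> j /=; rewrite !num_seq_nil; first by move=> h; case: eqP => // e; lia.
  move=> j0 j1 _; have -> : j = 0 by lia.
  by [].
set c := map succn b in weak strict *; set s := sumn b in weak strict *.
have mono (x y : int) : x <= y -> 2 * y <= s%:Z -> (num_seq c x <= num_seq c y)%N.
  move=> xy; have [m ->] : exists m : nat, y = x + m%:Z.
    by exists `|y - x|%N; lia.
  elim: m => [|m IH]; first by rewrite addr0.
  move=> h; apply: leq_trans (IH _) _; first by lia.
  have -> : x + m%:Z = x + m.+1%:Z - 1 by lia.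
  exact: weak.
have sym (j : int) : exists2 j' : int, num_seq c j = num_seq c j' &
    (j' = j \/ j' = s%:Z - j) /\ (j' <= j /\ j' <= s%:Z - j).
  have [h|h] := lerP j (s%:Z - j); first by exists j => //; split; [left|lia].
  by exists (s%:Z - j); [rewrite num_seq_sym|split; [right|lia]].
rewrite /= -/c -/s; split=> j.
  move=> h; have := num_seq_diff k c j; have [j' -> [h1 h2]] := sym j.
  suff : (num_seq c (j - k.+1%:Z) <= num_seq c j')%N by lia.
  by apply: mono; lia.
move=> j0 h hx; have := num_seq_diff k c j; have [j' -> [h1 h2]] := sym j.
suff : (num_seq c (j - k.+1%:Z) < num_seq c j')%N by lia.
have hk : k%:Z <= (k + s)%:Z - j by apply: hx; rewrite inE eqxx.
(* A place between the two arguments where the shorter list increases strictly. *)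
pose i : int := Num.max 0 (j - k%:Z).
have [i1 i2] : (0 <= i /\ j - k%:Z <= i) /\ (i = 0 \/ i = j - k%:Z) by rewrite /i; lia.
apply: leq_ltn_trans (_ : num_seq c (i - 1) < _)%N; first by apply: mono; lia.
apply: leq_trans (strict i _ _ _) _; rewrite ?mono //; try lia.
move=> x xb; have := hx x; rewrite inE xb orbT => /(_ isT).
case: i2 => ->; last by lia.
rewrite subr0 => _; rewrite /s; elim: (b) xb => //= y b' IH.
by rewrite inE => /predU1P[->|/IH]; lia.
Qed.

Lemma size_mons n (k : 'I_n -> nat) d : size (mons k d) = num_seq (ord_seq k) d%:Z.
Proof.
rewrite size_map size_filter /num_seq -sum1_count big_mkcond; apply: eq_bigr => be _.
by rewrite eqz_nat eq_sym; case: eqP.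
Qed.

(** Degree d + 1 mirrors degree d - 1, and the step up to the middle degree d is strict since no b_i
    exceeds d. *)
Lemma size_mons_lt n (b : 'I_n -> nat) d : (\sum_i b i = 2 * d)%N ->
  (forall i, b i <= d)%N ->
  (size (mons (fun i => (b i).+1) d.+1) < size (mons (fun i => (b i).+1) d))%N.
Proof.
move=> sb bd; rewrite !size_mons.
have -> : ord_seq (fun i => (b i).+1) = map succn (ord_seq b) by rewrite /ord_seq -map_comp.
have sE : sumn (ord_seq b) = (2 * d)%N by rewrite sumn_ord_seq sb.
rewrite -num_seq_sym sE (_ : _ - _ = d%:Z - 1); last by lia.
apply: (proj2 (num_seq_unimodal _)); rewrite ?sE //; try lia.
by move=> x /mapP[i _ ->]; have := bd i; lia.
Qed.

End Counting.


(** * Kernel elements and the Frobenius substitution *)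

Section FrobeniusKernel.
Local Open Scope ring_scope.
Variables (K : fieldType) (n : nat).
Implicit Types (f g lp : {mpoly K[n]}) (m : 'X_{1..n}).

Lemma kernel_exists (k : 'I_n -> nat) d lp : lp \is 1.-homog ->
    (size (mons k d.+1) < size (mons k d))%N ->
  exists f, [/\ f \is d.-homog, exists2 m, below k m & f@_m != 0 &
    forall m, below k m -> (lp * f)@_m = 0].
Proof.
move=> hlp lt; pose A := mons k d; pose B := mons k d.+1.
pose a (i : 'I_(size A)) := nth 0%MM A i; pose b (l : 'I_(size B)) := nth 0%MM B l.
have ha i : below k (a i) /\ mdeg (a i) = d.
  by have := mem_nth 0%MM (ltn_ord i); rewrite mem_mons => /andP[? /eqP ?]; split.
pose M : 'M[K]_(size A, size B) := \matrix_(i, l) (lp * 'X_[a i])@_(b l).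
have kn0 : kermx M != 0.
  rewrite kermx_eq0 /row_free; apply: contraTN lt => /eqP e.
  by rewrite -leqNgt -e rank_leq_col.
have /rowV0Pn[u /sub_kermxP uM un0] := kn0.
pose f : {mpoly K[n]} := \sum_i u 0 i *: 'X_[a i].
have fa i : f@_(a i) = u 0 i.
  rewrite raddf_sum /= (bigD1 i) //= mcoeffZ mcoeffX eqxx mulr1 big1 ?addr0 //.
  move=> j ne; rewrite mcoeffZ mcoeffX; case: eqP => [e|]; last by rewrite mulr0.
  by case/eqP: ne; apply/val_inj/eqP; rewrite /= -(nth_uniq 0%MM _ _ (mons_uniq k d)) //; apply/eqP.
have hf : f \is d.-homog.
  apply: rpred_sum => i _; apply: dhomogZ; rewrite dhomogX /=.
  by have [_ ->] := ha i.
exists f; split=> //.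
  have /rV0Pn[i ui] := un0.
  by exists (a i); [case: (ha i)|rewrite fa].
move=> m hm; have hlf : lp * f \is (d.+1).-homog.
  by rewrite -[d.+1]add1n; apply: dhomogM.
have [md|/(dhomog_nemf_coeff hlf)//] := eqVneq (mdeg m) d.+1.
have : m \in B by rewrite mem_mons hm md eqxx.
move=> /(nthP 0%MM)[l hl bl].
have -> : m = b (Ordinal hl) by rewrite /b bl.
move/matrixP/(_ 0 (Ordinal hl)): uM; rewrite !mxE => <-.
rewrite mulr_sumr raddf_sum /=; apply: eq_bigr => i _.
by rewrite -scalerAr mcoeffZ !mxE.
Qed.

Section Frobenius.
Variables (p e : nat) (hp : p \in [pchar K]).
Let q := (p ^ e)%N.

Let q0 : (0 < q)%N.
Proof. by rewrite expn_gt0 prime_gt0 // (pcharf_prime hp). Qed.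

Lemma sum_expr_q (I : Type) (r : seq I) (F : I -> {mpoly K[n]}) :
  (\sum_(i <- r) F i) ^+ q = \sum_(i <- r) F i ^+ q.
Proof.
apply: (big_morph (fun x => x ^+ q)) => [x y|]; last by rewrite expr0n gtn_eqF.
by apply: exprDn_pchar; rewrite pnatX pnatE ?(pcharf_prime hp) // pchar_lalg hp.
Qed.

Definition scale_vars f : {mpoly K[n]} := f \mPo [tuple 'X_i ^+ q | i < n].

Lemma scale_varsX m : scale_vars 'X_[m] = 'X_[(m *+ q)%MM].
Proof.
rewrite /scale_vars comp_mpolyX [RHS]mpolyXE_id; apply: eq_bigr => i _.
by rewrite tnth_mktuple -exprM mulmnE mulnC.
Qed.

Lemma scale_varsE f : scale_vars f = \sum_(m <- msupp f) f@_m *: 'X_[(m *+ q)%MM].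
Proof.
rewrite {1}(mpolyE f) /scale_vars raddf_sum /=; apply: eq_bigr => m _.
by rewrite comp_mpolyZ -scale_varsX.
Qed.

Lemma scale_mnm_inj m m' : (m *+ q)%MM = (m' *+ q)%MM -> m = m'.
Proof.
move/mnmP => h; apply/mnmP => i; have /eqP := h i.
by rewrite !mulmnE eqn_pmul2r // => /eqP.
Qed.

Lemma mcoeff_scale_vars f m : (scale_vars f)@_(m *+ q)%MM = f@_m.
Proof.
rewrite scale_varsE raddf_sum /=; under eq_bigr do rewrite mcoeffZ mcoeffX.
have [mf|mf] := boolP (m \in msupp f).
  rewrite (bigD1_seq m) ?msupp_uniq //= eqxx mulr1 big1 ?addr0 // => m' ne.
  by case: eqP => [/scale_mnm_inj e'|]; [rewrite e' eqxx in ne|rewrite mulr0].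
rewrite (memN_msupp_eq0 mf) big_seq big1 // => m' mf'.
by case: eqP => [/scale_mnm_inj e'|]; [rewrite -e' mf' in mf|rewrite mulr0].
Qed.

Lemma mcoeff_scale_vars_neq0 f m : (scale_vars f)@_m != 0 ->
  exists2 m', m = (m' *+ q)%MM & f@_m' != 0.
Proof.
move=> nz; apply: contrapT => h; case/negP: nz; apply/eqP.
rewrite scale_varsE raddf_sum /= big_seq big1 // => m' mf.
rewrite mcoeffZ mcoeffX; case: eqP => [e'|]; last by rewrite mulr0.
by case: h; exists m'; rewrite // -mcoeff_msupp.
Qed.

(** The linear form that becomes lp^q under x_i -> x_i^q; a kernel element of it is what gets
    substituted. *)
Definition frob lp : {mpoly K[n]} := \sum_(m <- msupp lp) lp@_m ^+ q *: 'X_[m].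

Lemma frob_homog lp : lp \is 1.-homog -> frob lp \is 1.-homog.
Proof.
move=> /dhomogP h; rewrite /frob big_seq; apply: rpred_sum => m mf.
by apply: dhomogZ; rewrite dhomogX /= (h _ mf).
Qed.

Lemma scale_vars_frob lp : scale_vars (frob lp) = lp ^+ q.
Proof.
rewrite {2}(mpolyE lp) sum_expr_q /frob /scale_vars raddf_sum /=.
apply: eq_bigr => m _; rewrite comp_mpolyZ exprZn.
by have := scale_varsX m; rewrite /scale_vars => ->; rewrite mpolyXn.
Qed.

Lemma scale_varsM f g : scale_vars (f * g) = scale_vars f * scale_vars g.
Proof. exact: rmorphM. Qed.

End Frobenius.

End FrobeniusKernel.


Lemma mnm_sub_exists n (m : 'X_{1..n}) t : (t <= mdeg m)%N ->
  exists2 m', (m' <= m)%MM & mdeg m' = t.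
Proof.
elim: t => [|t IH] h.
  exists 0%MM; rewrite ?mdeg0 //.
  by apply/mnm_lepP => i; rewrite mnm0E.
have [m' le e] := IH (ltnW h).
have [i lti] : exists i, (m' i < m i)%N.
  apply: contrapT => ne; move: h; rewrite -e ltnNge => /negP; apply.
  rewrite !mdegE; apply: leq_sum => i _; rewrite leqNgt; apply/negP => lt.
  by apply: ne; exists i.
exists (U_(i) + m')%MM; last by rewrite mdegD mdeg1 e.
apply/mnm_lepP => j; rewrite mnmDE mnm1E; case: eqP => [<-//|_].
by rewrite add0n; exact: (mnm_lepP le).
Qed.

(** * Obstructions to maximal rank *)

Section NotWLP.
Local Open Scope ring_scope.
Variables (K : fieldType) (n : nat) (c : expvec n).
Implicit Types (f g lp h : {mpoly K[n]}) (m : 'X_{1..n}).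

(* Multiplication into the socle is a perfect pairing, so a form killed by [lp] obstructs surjectivity in the dual degree, hence also in any lower one. *)
Lemma not_Surj lp h m d : lp * h \in ci_ideal (K := K) c -> standard c m -> mdeg m = d ->
  h@_m != 0 -> (2 * d < socdeg c)%N -> ~ Surj c lp d.
Proof.
move=> lh hm md nz lt surj.
have [|k le kd] := @mnm_sub_exists n (soc c - m)%MM d.+1.
  by have := mdeg_socB hm; rewrite md; lia.
have [|f _ hf] := surj 'X_[k]; first by rewrite dhomogX /= kd.
set a := (soc c - m - k)%MM.
case/negP: nz; apply/eqP.
have : h * 'X_[(soc c - m)%MM] \in ci_ideal (K := K) c.
  have -> : h * 'X_[(soc c - m)%MM] =
      'X_[a] * f * (lp * h) - h * 'X_[a] * (lp * f - 'X_[k]).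
    rewrite -{1}(submK le) mpolyXD -/a mulrBr opprB addrC mulrA.
    have -> : 'X_[a] * f * (lp * h) = h * 'X_[a] * (lp * f).
      by rewrite [lp * h]mulrC mulrACA ['X_[a] * h]mulrC [f * lp]mulrC.
    by rewrite subrK.
  by apply: rpredB; apply: idealMr.
move=> /ci_idealP /(_ (soc c)); rewrite standard_soc lepm_refl => /(_ isT).
rewrite -{1}(submK (m := m) (m' := soc c)); last by rewrite -standard_soc.
by rewrite mcoeffMX.
Qed.

Lemma not_WLP p e (b : 'I_n -> nat) d : p \in [pchar K] ->
    (\sum_i b i = 2 * d)%N -> (forall i, b i <= d)%N ->
    (forall i, p ^ e * b i < expo c i)%N ->
    (\sum_i dist (expo c i) (p ^ e * (b i).+1) < (n - 2) * (p ^ e).-1)%N ->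
  ~ WLP K c.
Proof.
move=> hp sb bd qb near /WLP_P[lp hlp h].
set q := (p ^ e)%N in qb near.
have q0 : (0 < q)%N by rewrite expn_gt0 prime_gt0 // (pcharf_prime hp).
have [f [hf [m0 m0b fm0] kf]] := kernel_exists (frob_homog p e hlp) (size_mons_lt sb bd).
pose w : 'X_{1..n} := [multinom (expo c i - q * (b i).+1)%N | i < n].
pose h0 := scale_vars p e f * 'X_[w].
pose m1 := (w + m0 *+ q)%MM.
have m1b : standard c m1.
  apply/forallP => i; rewrite mnmDE mulmnE mnmE.
  have := forallP m0b i; rewrite ltnS => le.
  have := qb i; have := leq_mul (leqnn q) le; rewrite [(m0 i * q)%N]mulnC mulnS.
  by move: q0; clear; lia.
have h0m1 : h0@_m1 != 0 by rewrite mcoeffMX (mcoeff_scale_vars e hp).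
(* A monomial of the product has exponent w + q m'; if m'_i > b_i for some i, it already exceeds the
   bound c_i, and otherwise its coefficient is one that [kf] makes zero. *)
have h0I : lp ^+ q * h0 \in ci_ideal (K := K) c.
  rewrite mulrA -(scale_vars_frob e hp) -scale_varsM; apply/ci_idealP => m mb.
  have [/submK <-|/forallPn[i]] := boolP (w <= m)%MM; last first.
    by rewrite -ltnNge; apply: mcoeffMX_notle.
  rewrite addmC mcoeffMX; apply/eqP/negPn/negP => /mcoeff_scale_vars_neq0[m' e' nz].
  case/negP: nz; apply/eqP/kf/forallP => i.
  rewrite ltnNge; apply/negP => le; have := forallP mb i.
  move/mnmP/(_ i): e'; rewrite mulmnE mnmBE mnmE -/q => e'.
  have := leq_mul (leqnn q) le; rewrite [(m' i * q)%N]mulnC in e' *.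
  have : (0 < q * (b i).+1)%N by rewrite muln_gt0 q0.
  by move: e'; move: (q * _)%N (q * _)%N; clear; lia.
pose P j := lp ^+ j * h0 \in ci_ideal (K := K) c.
have exP : exists j, P j by exists q.
case: (ex_minnP exP) => j Pj jmin.
case: j Pj jmin => [|j] Pj jmin.
  move: Pj; rewrite /P expr0 mul1r => /ci_idealP /(_ m1 m1b) e1.
  by rewrite e1 eqxx in h0m1.
have jq : (j < q)%N by apply: jmin.
have nPj : ~ (lp ^+ j * h0 \in ci_ideal (K := K) c).
  by move=> /jmin; rewrite ltnn.
have hj : lp ^+ j * h0 \is (j + (q * d + mdeg w)).-homog.
  apply: dhomogM; first by rewrite -[X in X.-homog]mul1n; apply: dhomogMn.
  apply: dhomogM; last by rewrite dhomogX.
  apply/dhomogP => m; rewrite mcoeff_msupp => /mcoeff_scale_vars_neq0[m' -> nz].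
  rewrite /= mdegMn mulnC; congr (_ * _)%N.
  by apply/eqP; apply: contraNT nz => /(dhomog_nemf_coeff hf) ->.
set D := (j + _)%N in hj.
(* With v = c - q (1 + b), s = 2 q d + n (q - 1) + |v+| - |v-|; as j <= q - 1, s - 2 D is at least
   (n - 2) (q - 1) - |v|. *)
have lD : (2 * D < socdeg c)%N.
  have sw : (\sum_i (expo c i + (q * (b i).+1 - expo c i)) = \sum_i (q * (b i).+1 + w i))%N.
    by apply: eq_bigr => i _; rewrite mnmE; clear; lia.
  have sd : (\sum_i dist (expo c i) (q * (b i).+1) = \sum_i (w i + (q * (b i).+1 - expo c i)))%N.
    by apply: eq_bigr => i _; rewrite mnmE.
  have se : (\sum_i expo c i = socdeg c + n)%N.
    rewrite /socdeg -[X in (_ + X)%N]card_ord -sum1_card -big_split /=.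
    by apply: eq_bigr => i _; have := expo_gt0 c i; lia.
  have sq : (\sum_i q * (b i).+1 = q * (2 * d) + q * n)%N.
    rewrite -big_distrr /= -mulnDr -sb -[X in (_ + X)%N]card_ord -sum1_card -big_split /=.
    by congr (_ * _)%N; apply: eq_bigr => i _; rewrite addn1.
  move: sw near; rewrite sd !big_split /= se sq -mdegE /D.
  move: (\sum_i (_ - _))%N (mdeg w) (socdeg c) => U W s.
  case: (q) q0 jq => // q' _; rewrite ltnS /= => jq.
  case: (n) => [|[|n']]; rewrite ?subn0 ?mul0n ?ltn0 //.
  rewrite -[(n'.+2 - 2)%N]/(n' - 0)%N subn0 !mulSn !mulnS.
  rewrite [(q' * n')%N]mulnC !mul0n !addn0 mulnDr.
  by move: jq; move: (n' * q')%N (q' * d)%N; clear; lia.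
have [i|surj] := h D.
  by apply: nPj; apply: i => //; rewrite mulrA -exprS.
have [m mb nz] : exists2 m, standard c m & (lp ^+ j * h0)@_m != 0.
  apply: contrapT => ne; apply: nPj; apply/ci_idealP => m mb.
  by apply/eqP/negPn/negP => nz; apply: ne; exists m.
apply: (not_Surj _ mb _ nz lD surj); first by rewrite mulrA -exprS.
by apply/eqP; apply: contraNT nz => /(dhomog_nemf_coeff hj) ->.
Qed.

End NotWLP.

Definition polygonal n (b : 'I_n -> nat) : Prop :=
  ~~ odd (\sum_i b i) /\ forall i, 2 * b i <= \sum_i b i.

(* An apex far beyond [c] in the [i]-th coordinate can be moved back by one step there, together with its largest other coordinate. *)
Lemma polygonal_shrink n q (c b : 'I_n -> nat) :
    (forall i, 0 < c i) -> polygonal b ->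
  exists b', [/\ polygonal b', forall i, q * b' i < c i &
    \sum_i dist (c i) (q * (b' i).+1) <= \sum_i dist (c i) (q * (b i).+1)].
Proof.
move=> c0; have [N] := ubnP (\sum_i b i); elim: N b => // N IH b.
rewrite ltnS => sN [ob mb].
have [ok|/forallPn[i]] := boolP [forall i, q * b i < c i].
  by exists b; split=> //; exact/forallP.
rewrite -leqNgt => ci.
have bi : 0 < b i by have := c0 i; case: (b i) ci => //; rewrite muln0 leqn0 => /eqP ->.
have [j0 ji0 bj0] : exists2 j, j != i & 0 < b j.
  apply: contrapT => ne; have := mb i; rewrite (bigD1 i) //= big1 ?addn0; first by lia.
  move=> j ji; apply/eqP; rewrite -leqn0 leqNgt; apply/negP => bj.
  by apply: ne; exists j.
case: (arg_maxnP (P := fun j => j != i) b ji0) => j ji jmax.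
have bj : 0 < b j := leq_trans bj0 (jmax _ ji0).
pose b' k := b k - (k == i) - (k == j).
have bb' k : b' k + (k == i) + (k == j) = b k.
  rewrite /b'; case: (eqVneq k i) => [->|_]; first by rewrite eq_sym (negPf ji); lia.
  by case: eqP => [->|_]; lia.
have delta l : \sum_(k < n) (k == l :> 'I_n) = 1.
  by rewrite (bigD1 l) //= eqxx big1 ?addn0 // => k /negPf->.
have sb : \sum_k b k = (\sum_k b' k) + 2.
  under eq_bigr do rewrite -bb'.
  by rewrite !big_split /= !delta addn1 addn1 addn2.
have [||b2 [h1 h2 h3]] := IH b'.
- by move: sN; rewrite sb; lia.
- split; first by move: ob; rewrite sb oddD addbF.
  move=> k; have [ki|ki] := eqVneq k i.
    by have := mb i; have := bb' k; rewrite ki eqxx eq_sym (negPf ji) sb; lia.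
  have [kj|kj] := eqVneq k j.
    by have := mb j; have := bb' k; rewrite kj eqxx (negPf ji) sb; lia.
  have bk := jmax _ ki; have ek := bb' k; rewrite (negPf ki) (negPf kj) !addn0 in ek.
  (* As b_k <= b_j and b_i > 0, the sum exceeds 2 b_k, and by parity it does so by at least 2. *)
  have : b i + (b j + b k) <= \sum_k b k.
    rewrite (bigD1 i) //= leq_add2l (bigD1 j) //= leq_add2l (bigD1 k) //=.
    by rewrite leq_addr.
    by rewrite ki kj.
  by move: ob; rewrite sb ek; clear -bi bk; lia.
exists b2; split=> //; apply: leq_trans h3 _.
rewrite (bigD1 i) //= [X in _ <= X](bigD1 i) //= (bigD1 j) //= [X in _ <= _ + X](bigD1 j) //=.
rewrite !addnA; apply: leq_add; last first.
  apply: leq_sum => k /andP[ki kj].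
  by rewrite -(bb' k) (negPf ki) (negPf kj) !addn0.
(* The distance in coordinate i drops by exactly q and that in coordinate j grows by at most q. *)
have := bb' i; have := bb' j; rewrite !eqxx (negPf ji) eq_sym (negPf ji) !addn0.
move=> <- ei; rewrite -ei addn1 in ci *; rewrite addn1.
rewrite ![q * _.+2]mulnS ![q * _.+1]mulnS; rewrite mulnS in ci.
move: ci; rewrite /dist; clear; move: (q * _) (q * _) => x y; lia.
Qed.

Lemma dists_ord_seq n (f g : 'I_n -> nat) :
  dists (ord_seq f) (ord_seq g) = \sum_i dist (f i) (g i).
Proof. by rewrite /dists /ord_seq zip_map big_map big_enum. Qed.

(** * Apices for vectors that fail the WLP, and the two inclusions *)

Local Open Scope classical_set_scope.
Local Open Scope ring_scope.

Lemma exists_apex (K : fieldType) n p (c : expvec n) : p \in [pchar K] -> (1 < n)%N -> ~ WLP K c ->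
  exists e b, [/\ (0 < e)%N, polygonal b, forall i, (p ^ e * b i < expo c i)%N &
    (\sum_i dist (expo c i) (p ^ e * (b i).+1) < (n - 2) * (p ^ e).-1)%N].
Proof.
move=> hp n1 nW.
have [d [lt ninj]] : exists d, (2 * d < socdeg c)%N /\ ~ Inj c (sum_vars K n) d.
  apply: contrapT => ne; apply: nW; apply: WLP_of_Inj => d lt.
  by apply: contrapT => ni; apply: ne; exists d.
have [f [hf lf nf]] : exists f, [/\ f \is d.-homog,
    sum_vars K n * f \in ci_ideal (K := K) c & f \notin ci_ideal (K := K) c].
  apply: contrapT => ne; apply: ninj => f hf lf.
  by apply/negPn/negP => nf; apply: ne; exists f.
have [||e [b [bs [gb sb le]]]] := Kern_near hp _ _ (Kern_of hf lf nf).
- by apply/allP => x /mapP[i _ ->]; apply: expo_gt0.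
- by rewrite size_ord_seq.
rewrite size_ord_seq in sb le.
pose bf (i : 'I_n) := nth 0%N (b :: bs) i.
have bE : b :: bs = ord_seq bf.
  apply: (@eq_from_nth _ 0%N); first by rewrite size_ord_seq.
  by move=> i; rewrite /= sb => hi; rewrite (nth_ord_seq _ _ (Ordinal hi)).
have sbf : (\sum_i bf i = b + sumn bs)%N by rewrite -sumn_ord_seq -bE.
have [o1 o2 o3] := fan_bound gb.
have pbf : polygonal bf.
  rewrite /polygonal sbf; split=> // i.
  have : bf i \in b :: bs by rewrite bE map_f ?mem_enum.
  by rewrite inE => /predU1P[->|/o3 //]; lia.
(* The ball contains positive vectors only, so c_i > q b_i must be arranged. *)
have [b' [h1 h2 h3]] := polygonal_shrink (p ^ e) (fun i => expo_gt0 c i) pbf.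
exists e, b'.
have se : (\sum_i expo c i = socdeg c + n)%N.
  rewrite /socdeg -[X in (_ + X)%N]card_ord -sum1_card -big_split /=.
  by apply: eq_bigr => i _; have := expo_gt0 c i; lia.
rewrite sumn_ord_seq se /near bE -map_comp dists_ord_seq in le.
have le' : (\sum_i dist (expo c i) (p ^ e * (b' i).+1) < (n - 2) * (p ^ e).-1)%N.
  apply: leq_ltn_trans h3 _.
  by move: le lt; rewrite /=; move: (\sum_i _)%N (_ * _)%N; clear; lia.
(* At e = 0 the right-hand side is 0 and the strict inequality fails. *)
split=> //; rewrite lt0n; apply: contraTneq le' => ->.
by rewrite expn0 muln0 ltn0.
Qed.


Theorem theorem1 (n p : nat) (K : fieldType)
    (hn : (3 <= n)%N) (hp : prime p) (hK : p \in [pchar K]) :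
  NL K n =
    Zge2 n `&`
    \bigcup_(e in [set e : nat | (1 <= e)%N]) \bigcup_(b in Gamma n)
      let q : int := (p ^ e)%N%:Z in
      [set u + q *: b | u in posball (radius n q) (q *: const_mx 1)].
Proof.
have normE (F : 'I_n -> int) : \sum_i `|F i| = (\sum_i `|F i|%N)%N%:Z.
  by rewrite (big_morph Posz PoszD (erefl _)); apply: eq_bigr => i _; rewrite abszE.
(* The 1 turns the bound by the radius into the strict inequality used above. *)
have radiusE q : (0 < q)%N -> radius n q%:Z + 1 = ((n - 2) * q.-1)%N%:Z.
  move=> q0; rewrite /radius subrK PoszM; congr (_ * _); lia.
have q0 e : (0 < p ^ e)%N by rewrite expn_gt0 prime_gt0.
apply/seteqP; split=> c0.
  move=> [c nW <-]; split; first exact: expvecP.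
  have [e [b [e0 [ob mb] qb le]]] := exists_apex hK (ltnW hn) nW.
  exists e => //; pose bv : 'rV[int]_n := \row_i (b i)%:Z.
  have nb : norm1 bv = (\sum_i b i)%N%:Z.
    by rewrite /norm1 normE; congr Posz; apply: eq_bigr => i _; rewrite mxE.
  have cE i : expval c 0 i = (expo c i)%:Z.
    by have := expvecP c i; rewrite /expo; lia.
  exists bv.
    split; rewrite ?nb.
    - by move=> i; rewrite mxE.
    - by rewrite dvdzE /= dvdn2.
    - apply: (big_ind (fun x : int => 2 * x <= (\sum_i b i)%N%:Z)) => //.
      + by move=> x y; rewrite maxEle; case: ifP.
      + by move=> i _; rewrite mxE; have := mb i; move: (\sum_i _)%N; lia.
  exists (expval c - (p ^ e)%N%:Z *: bv); last by rewrite subrK.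
  split; first by move=> i; have := qb i; rewrite !mxE cE; lia.
  rewrite -ltzD1 radiusE //.
  rewrite /norm1 normE.
  have -> : (\sum_i `|((expval c - (p ^ e)%N%:Z *: bv - (p ^ e)%N%:Z *: const_mx 1) 0 i)%R|%N
      = \sum_i dist (expo c i) (p ^ e * (b i).+1))%N.
    apply: eq_bigr => i _; rewrite !mxE cE mulr1 mulnS /dist -PoszM.
    by move: (p ^ e * b i)%N (p ^ e)%N (expo c i); clear; lia.
  by move: le; move: (\sum_i _)%N (_ * _)%N; clear; lia.
move=> [c2 [e /= e0 [b [b0 ob mb] [u [u1 ur] uE]]]].
pose c := Expvec c2; exists c => //.
pose bf i := `|(b 0 i)%R|%N.
have bE i : b 0 i = (bf i)%:Z by have := b0 i; rewrite /bf; lia.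
have nb : norm1 b = (\sum_i bf i)%N%:Z by rewrite /norm1 normE.
have cE i : (expo c i)%:Z = u 0 i + (p ^ e)%N%:Z * (bf i)%:Z.
  have := c2 i; rewrite /expo /= -uE !mxE bE.
  by move: (_ + _); lia.
move: ob; rewrite nb dvdzE /= dvdn2 => ob.
have sd : (\sum_i bf i = 2 * (\sum_i bf i)./2)%N.
  by rewrite mul2n; move: ob; move: (\sum_i _)%N; clear; lia.
apply: (not_WLP (p := p) (e := e) (b := bf) hK sd).
- move=> i; have := le_trans (ler_wpM2l _ (le_bigmax 0 (fun i => b 0 i) i)) mb.
  rewrite nb bE => /(_ isT); move: ob; move: (\sum_i _)%N (bf i); clear; lia.
- by move=> i; have := u1 i; have := cE i; rewrite -PoszM; lia.
rewrite -ltz_nat -radiusE // ltzD1; apply: le_trans ur.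
rewrite /norm1 normE lez_nat; apply: eq_leq; apply: eq_bigr => i _.
have := cE i; rewrite !mxE mulr1 mulnS /dist -PoszM.
by move: (p ^ e * bf i)%N (p ^ e)%N (expo c i) (u 0 i); clear; lia.
Qed.
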